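(* No Oeljeklaus-Toma manifold $X(K,U)$, of any type $(s,t)$, admits a strongly Gauduchon metric.
   Context: Oeljeklaus-Toma manifolds: let $s,t\ge 1$ be integers and $K$ a number field with exactly $s$ real embeddings $\sigma_1,\dots,\sigma_s$ and $2t$ non-real complex embeddings $\sigma_{s+1},\dots,\sigma_{s+2t}$, labelled so that $\sigma_{s+t+j}=\overline{\sigma_{s+j}}$ for $1\le j\le t$. Let $\mathcal O_K$ be the ring of integers and $\mathcal O_K^{*,+}$ the group of totally positive units (units $u$ with $\sigma_j(u)>0$ for $1\le j\le s$). Let $\mathbb H\subset\mathbb C$ be the upper half-plane. On $\mathbb H^s\times\mathbb C^t$, $a\in\mathcal O_K$ acts by translation by $(\sigma_1(a),\dots,\sigma_{s+t}(a))$ and $u\in\mathcal O_K^{*,+}$ acts by multiplying the $j$-th coordinate by $\sigma_j(u)$. A subgroup $U\subset\mathcal O_K^{*,+}$ of rank $s$ is admissible if the resulting fixed-point-free action of $\mathcal O_K\rtimes U$ on $\mathbb H^s\times\mathbb C^t$ is properly discontinuous and co-compact (by construction $\{(\log\sigma_1(u),\dots,\log\sigma_s(u)):u\in U\}$ is a lattice of rank $s$ in $\mathbb R^s$). For admissible $U$, the Oeljeklaus-Toma manifold of type $(s,t)$ is the compact complex manifold $X(K,U)=(\mathbb H^s\times\mathbb C^t)/(\mathcal O_K\rtimes U)$, of complex dimension $n=s+t$. A strongly Gauduchon metric on a complex manifold of complex dimension $n$ is a Hermitian metric whose associated $(1,1)$-form $\omega=g(J\cdot,\cdot)$ is such that $\partial\omega^{n-1}$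 is $\overline\partial$-exact. *)

(* Defs.v *)
From HB Require Import structures.
From mathcomp Require Import all_boot all_order all_algebra all_field.
From mathcomp Require Import complex ring.
From mathcomp Require Import all_classical all_reals all_analysis.

Set Implicit Arguments.
Unset Strict Implicit.
Unset Printing Implicit Defensive.

Import Order.TTheory GRing.Theory Num.Theory.
Import numFieldNormedType.Exports.

Local Open Scope classical_set_scope.
Local Open Scope ring_scope.

(* C^n is modelled by its underlying real vector space R^(n + n): the vector
   (x_0, .., x_(n-1), y_0, .., y_(n-1)) stands for (x_j + i y_j)_j.            *)
Notation "''E[' R ]_ n" := ('rV[R]_(n + n))
  (at level 8, n at level 2, format "''E[' R ]_ n").

Section CoordinateSpace.
Context {R : realType}.
Implicit Types n : nat.

Definition zcoord n (v : 'E[R]_n) (j : 'I_n) : R[i] :=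
  Complex (v 0 (lshift n j)) (v 0 (rshift n j)).

Definition ofzcoord n (z : 'I_n -> R[i]) : 'E[R]_n :=
  row_mx (\row_j complex.Re (z j)) (\row_j complex.Im (z j)).

(* v *m Jmx is multiplication by i, (x, y) |-> (- y, x). *)
Definition Jmx n : 'M[R]_(n + n) := block_mx 0 1%:M (- 1%:M) 0.

Definition partial m (a : 'I_m) (f : 'rV[R]_m -> R) : 'rV[R]_m -> R :=
  'D_(delta_mx 0 a) f.

(* C^oo on an open set A: all iterated partial derivatives exist and are
   continuous at the points of A. *)
Definition smooth_on m (A : set 'rV[R]_m) (f : 'rV[R]_m -> R) : Prop :=
  forall (l : seq 'I_m) (x : 'rV[R]_m), A x ->
    let F := foldr (@partial m) f l in
    {for x, continuous F} /\ forall a : 'I_m, derivable F x (delta_mx 0 a).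

(* Row convention: the differential of f at x is v |-> v *m jac f x. *)
Definition jac m p (f : 'rV[R]_m -> 'rV[R]_p) (x : 'rV[R]_m) : 'M[R]_(m, p) :=
  \matrix_(a, b) partial a (fun y => f y 0 b) x.

(* Smooth with C-linear differential. *)
Definition holomorphic_on n p (A : set 'E[R]_n) (f : 'E[R]_n -> 'E[R]_p) :=
  (forall b, smooth_on A (fun x => f x 0 b)) /\
  (forall x, A x -> Jmx n *m jac f x = jac f x *m Jmx p).

End CoordinateSpace.

(* Complex-valued exterior forms on C^n at a point.  The index lshift n j
   stands for dz_j and rshift n j for dzbar_j; the value of an element at the
   index set A is its coefficient on the wedge product of the corresponding
   1-forms, taken in increasing order of indices. *)
Notation ext R n := {ffun {set 'I_(n + n)} -> R[i]}.

Section ExteriorAlgebra.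
Context {R : realType} {n : nat}.

Definition ext1 : ext R n := [ffun A => (A == finset.set0)%:R].

Definition covec (k : 'I_(n + n)) : ext R n :=
  [ffun A => (A == [set k]%SET)%:R].

Definition dz (j : 'I_n) := covec (lshift n j).
Definition dzbar (j : 'I_n) := covec (rshift n j).

Definition shuffle_sign (A B : {set 'I_(n + n)}) : R[i] :=
  (-1) ^+ #|[set p : 'I_(n + n) * 'I_(n + n) |
              [&& p.1 \in A, p.2 \in B & (p.2 < p.1)%N]]%SET|.

Definition wedge (a b : ext R n) : ext R n :=
  [ffun C : {set 'I_(n + n)} => \sum_(A : {set 'I_(n + n)} | A \subset C)
     shuffle_sign A (finset.setD C A) * a A * b (finset.setD C A)].

Definition wedge_pow (k : nat) (a : ext R n) : ext R n :=
  iter k (wedge a) ext1.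

(* The real coordinate 1-forms dx_j and dy_j. *)
Definition dreal (a : 'I_(n + n)) : ext R n :=
  match fintype.split a with
  | inl j => 2%:R^-1 *: (dz j + dzbar j)
  | inr j => (2%:R * Complex 0 1)^-1 *: (dz j - dzbar j)
  end.

(* The 2-form omega = g(J ., .), i.e.
   1/2 sum_(a, b) g(J e_a, e_b) du_a /\ du_b, for the bilinear form g with
   Gram matrix G. *)
Definition fundamental_form (G : 'M[R]_(n + n)) : ext R n :=
  2%:R^-1 *: \sum_(a < n + n) \sum_(b < n + n)
    Complex ((Jmx n *m G) a b) 0 *: wedge (dreal a) (dreal b).

Definition cpartial (a : 'I_(n + n)) (f : 'E[R]_n -> R[i]) (x : 'E[R]_n) :
    R[i] :=
  Complex (partial a (fun y => complex.Re (f y)) x)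
          (partial a (fun y => complex.Im (f y)) x).

Definition ext_partial (a : 'I_(n + n)) (w : 'E[R]_n -> ext R n)
    (x : 'E[R]_n) : ext R n :=
  [ffun A : {set 'I_(n + n)} => cpartial a (fun y => w y A) x].

Definition wirtinger (j : 'I_n) (w : 'E[R]_n -> ext R n) (x : 'E[R]_n) :
    ext R n :=
  2%:R^-1 *: (ext_partial (lshift n j) w x
              - Complex 0 1 *: ext_partial (rshift n j) w x).

Definition wirtinger_bar (j : 'I_n) (w : 'E[R]_n -> ext R n) (x : 'E[R]_n) :
    ext R n :=
  2%:R^-1 *: (ext_partial (lshift n j) w x
              + Complex 0 1 *: ext_partial (rshift n j) w x).

Definition del (w : 'E[R]_n -> ext R n) (x : 'E[R]_n) : ext R n :=
  \sum_(j < n) wedge (dz j) (wirtinger j w x).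

Definition delbar (w : 'E[R]_n -> ext R n) (x : 'E[R]_n) : ext R n :=
  \sum_(j < n) wedge (dzbar j) (wirtinger_bar j w x).

Definition smooth_form_on (A : set 'E[R]_n) (w : 'E[R]_n -> ext R n) : Prop :=
  forall B : {set 'I_(n + n)},
    smooth_on A (fun x => complex.Re (w x B)) /\
    smooth_on A (fun x => complex.Im (w x B)).

(* The coordinates z_j and zbar_j, indexed like dz_j and dzbar_j. *)
Definition ccoord (k : 'I_(n + n)) (v : 'E[R]_n) : R[i] :=
  match fintype.split k with
  | inl j => zcoord v j
  | inr j => conjc (zcoord v j)
  end.

Definition pullback_covec (f : 'E[R]_n -> 'E[R]_n) (x : 'E[R]_n)
    (k : 'I_(n + n)) : ext R n :=
  \sum_(a < n + n) cpartial a (fun y => ccoord k (f y)) x *: dreal a.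

Definition pullback (f : 'E[R]_n -> 'E[R]_n) (w : 'E[R]_n -> ext R n)
    (x : 'E[R]_n) : ext R n :=
  \sum_(A : {set 'I_(n + n)})
    w (f x) A *: \big[wedge/ext1]_(k <- enum A) pullback_covec f x k.

End ExteriorAlgebra.

(* A chart of a space whose points lie in T: the domain, the coordinate map,
   and its inverse; the last two are only meaningful on the domain and on its
   image. *)
Record chart (R : realType) (n : nat) (T : Type) := Chart {
  cdom : set T;
  cmap : T -> 'E[R]_n;
  cinv : 'E[R]_n -> T }.

Section Charts.
Context {R : realType} {n : nat} {T : Type}.
Implicit Types c : chart R n T.

Definition ccod c : set 'E[R]_n := cmap c @` cdom c.
Definition overlap c c' : set 'E[R]_n := cmap c @` (cdom c `&` cdom c').
Definition transition c c' : 'E[R]_n -> 'E[R]_n := cmap c' \o cinv c.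

End Charts.

(* The topology is the one determined by the atlas; the last axiom says that it
   is Hausdorff.  Openness of the chart images is overlap_open with c' = c. *)
Record complexManifold (R : realType) (n : nat) := ComplexManifold {
  mtype : Type;
  mpoints : set mtype;
  atlas : set (chart R n mtype);
  atlas_cover : \bigcup_(c in atlas) cdom c = mpoints;
  chartK : forall c, atlas c -> forall x, cdom c x -> cinv c (cmap c x) = x;
  overlap_open : forall c c', atlas c -> atlas c' -> open (overlap c c');
  transition_holomorphic : forall c c', atlas c -> atlas c' ->
    holomorphic_on (overlap c c') (transition c c');
  atlas_hausdorff : forall x y, mpoints x -> mpoints y -> x <> y ->
    exists c c' (A A' : set 'E[R]_n),
      [/\ atlas c /\ atlas c', cdom c x /\ cdom c' y,
          [/\ open A, A `<=` ccod c & A (cmap c x)],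
          [/\ open A', A' `<=` ccod c' & A' (cmap c' y)] &
          (cinv c @` A) `&` (cinv c' @` A') = set0] }.

Arguments mpoints {R n} X _ : rename.
Arguments atlas {R n} X _ : rename.

Section HermitianGeometry.
Context {R : realType} {n : nat} (X : complexManifold R n).

(* Tensor fields are given by their local expressions in the charts. *)
Definition is_form (w : chart R n (mtype X) -> 'E[R]_n -> ext R n) : Prop :=
  (forall c, atlas X c -> smooth_form_on (ccod c) (w c)) /\
  (forall c c', atlas X c -> atlas X c' -> forall x, overlap c c' x ->
     w c x = pullback (transition c c') (w c') x).

(* J-invariant Riemannian metrics, given by Gram matrices. *)
Definition hermitian_metric
    (g : chart R n (mtype X) -> 'E[R]_n -> 'M[R]_(n + n)) : Prop :=
  [/\ forall c, atlas X c -> forall a b,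
        smooth_on (ccod c) (fun x => g c x a b),
      forall c c', atlas X c -> atlas X c' -> forall x, overlap c c' x ->
        g c x = jac (transition c c') x *m g c' (transition c c' x)
                  *m (jac (transition c c') x)^T,
      forall c, atlas X c -> forall x, ccod c x -> (g c x)^T = g c x,
      forall c, atlas X c -> forall x, ccod c x ->
        forall v : 'E[R]_n, v != 0 -> 0 < (v *m g c x *m v^T) 0 0 &
      forall c, atlas X c -> forall x, ccod c x ->
        Jmx n *m g c x *m (Jmx n)^T = g c x].

(* The primitive may have mixed degree; when w has type (p, q), replacing the
   primitive by its component of type (p, q - 1) gives a primitive again. *)
Definition delbar_exact (w : chart R n (mtype X) -> 'E[R]_n -> ext R n) :=
  exists2 al, is_form al &
    forall c, atlas X c -> forall x, ccod c x -> w c x = delbar (al c) x.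

Definition strongly_gauduchon
    (g : chart R n (mtype X) -> 'E[R]_n -> 'M[R]_(n + n)) : Prop :=
  hermitian_metric g /\
  delbar_exact
    (fun c => del (fun x => wedge_pow n.-1 (fundamental_form (g c x)))).

End HermitianGeometry.

Section NumberField.
Context {R : realType} {K : fieldExtType rat}.

(* sigma enumerates the embeddings of K in the order: s real ones, t non-real
   ones, and the conjugates of the latter. *)
Definition embeddings_of_type s t (sigma : 'I_(s + t + t) -> {rmorphism K -> R[i]}) :=
  [/\ forall i j, sigma i =1 sigma j -> i = j,
      forall tau : {rmorphism K -> R[i]}, exists i, tau =1 sigma i,
      forall (j : 'I_s) x, sigma (lshift t (lshift t j)) x \is Num.real,
      forall j : 'I_t,
        ~ (forall x, sigma (lshift t (rshift s j)) x \is Num.real) &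
      forall (j : 'I_t) x,
        sigma (rshift (s + t) j) x = conjc (sigma (lshift t (rshift s j)) x)].

Definition alg_integer (x : K) : Prop := integralOver (intr : int -> K) x.

Definition mult_independent k (u : 'I_k -> K) : Prop :=
  forall e : 'I_k -> int, \prod_(i < k) u i ^ e i = 1 -> forall i, e i = 0.

Definition has_rank (U : set K) (r : nat) : Prop :=
  (exists2 u : 'I_r -> K, forall i, U (u i) & mult_independent u) /\
  (forall u : 'I_r.+1 -> K, (forall i, U (u i)) -> ~ mult_independent u).

Context {s t : nat} (sigma : 'I_(s + t + t) -> {rmorphism K -> R[i]}).

Definition totally_positive_unit (u : K) : Prop :=
  [/\ u != 0, alg_integer u, alg_integer u^-1 &
      forall j : 'I_s, 0 < sigma (lshift t (lshift t j)) u].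

(* H^s x C^t *)
Definition ot_cover : set 'E[R]_(s + t) :=
  [set z | forall j : 'I_s, 0 < complex.Im (zcoord z (lshift t j))].

(* The action of (a, u), a translation after a multiplication. *)
Definition ot_act (g : K * K) (z : 'E[R]_(s + t)) : 'E[R]_(s + t) :=
  ofzcoord (fun j => sigma (lshift t j) g.2 * zcoord z j
                     + sigma (lshift t j) g.1).

Definition ot_group (U : set K) : set (K * K) :=
  [set g | alg_integer g.1 /\ U g.2].

Definition admissible (U : set K) : Prop :=
  [/\ U `<=` totally_positive_unit,
      [/\ U 1, forall u v, U u -> U v -> U (u * v) & forall u, U u -> U u^-1],
      has_rank U s,
      (* properly discontinuous *)
      forall C : set 'E[R]_(s + t), compact C -> C `<=` ot_cover ->
        finite_set (ot_group U `&`
          [set g | (ot_act g @` C) `&` C !=set0]) &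
      (* co-compact *)
      exists2 C : set 'E[R]_(s + t), compact C /\ C `<=` ot_cover &
        forall z, ot_cover z -> exists2 g, ot_group U g & C (ot_act g z)].

Definition ot_orbit (U : set K) (z : 'E[R]_(s + t)) : set 'E[R]_(s + t) :=
  [set ot_act g z | g in ot_group U].

(* The local inverse of the quotient map with values in V. *)
Definition ot_chart (U : set K) (V : set 'E[R]_(s + t)) :
    chart R (s + t) (set 'E[R]_(s + t)) :=
  Chart (ot_orbit U @` V) (fun O => get (O `&` V)) (ot_orbit U).

Definition ot_atlas (U : set K) :
    set (chart R (s + t) (set 'E[R]_(s + t))) :=
  [set c | exists V, [/\ open V, V `<=` ot_cover, {in V &, injective (ot_orbit U)} &
                         c = ot_chart U V]].

End NumberField.

(* The maps in the action of O_K x| U are, coordinatewise, affine in the real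
   coordinates; the lemmas below verify the axioms of a complex manifold for the
   quotient. *)
Section AffineMaps.
Context {R : realType}.

Definition affine2 m (i j : 'I_m) (p q d : R) (z : 'rV[R]_m) : R :=
  p * z 0 i + q * z 0 j + d.

Lemma affine2_is_derive m (i j : 'I_m) p q d (x v : 'rV[R]_m) :
  is_derive x v (affine2 i j p q d) (p * v 0 i + q * v 0 j).
Proof.
have cv : (fun h : R => h^-1 *: ((affine2 i j p q d \o shift x) (h *: v)
    - affine2 i j p q d x)) @ 0^' --> p * v 0 i + q * v 0 j.
  apply: cvg_near_cst; near=> h.
  have h0 : h != 0 by near: h; exact: nbhs_dnbhs_neq.
  rewrite /affine2 /= !mxE /GRing.scale /=; apply: (mulfI h0).
  rewrite mulrA divff // mul1r; ring.
split; first by apply/cvg_ex; eexists; exact: cv.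
exact: cvg_lim.
Unshelve. all: by end_near.
Qed.

Lemma affine2_continuous m (i j : 'I_m) p q d :
  continuous (affine2 i j p q d).
Proof.
move=> x; have cc k : {for x, continuous (fun z : 'rV[R]_m => z 0 k)}.
  exact: coord_continuous.
have cst c : {for x, continuous (fun z : 'rV[R]_m => c : R)}.
  exact: cst_continuous.
exact: (continuousD (continuousD (continuousM (cst p) (cc i))
                                 (continuousM (cst q) (cc j))) (cst d)).
Qed.

Lemma affine2_smooth m (i j : 'I_m) p q d : smooth_on setT (affine2 i j p q d).
Proof.
move=> l x _ F.
have [p' [q' [d' ->]]] : exists p' q' d', F = affine2 i j p' q' d'.
  rewrite {}/F; elim: l => [|a l [p' [q' [d' IH]]]] /=; first by exists p, q, d.
  exists 0, 0, (p' * (delta_mx 0 a : 'rV[R]_m) 0 i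
                + q' * (delta_mx 0 a : 'rV[R]_m) 0 j).
  apply/funext => y; rewrite IH /partial.
  have /@derive_val -> := affine2_is_derive i j p' q' d' y (delta_mx 0 a).
  by rewrite /affine2 !mul0r !add0r.
split; first exact: affine2_continuous.
by move=> a; have [] := affine2_is_derive i j p' q' d' x (delta_mx 0 a).
Qed.

Lemma smooth_on_germ m (A : set 'rV[R]_m) (f : 'rV[R]_m -> R) :
  (forall x, A x -> exists2 h, smooth_on setT h & \near x, f x = h x) ->
  smooth_on A f.
Proof.
move=> fA l x Ax F; have [h hs fh] := fA _ Ax.
have Fh : \near x, F x = foldr (@partial R m) h l x.
  rewrite {}/F; elim: l => //= a l /near_join IH.
  by apply: filterS IH => y IH; exact: near_eq_derive.
have [hc hd] := hs l x I; split.
  suff : F @ x --> F x by [].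
  rewrite (nbhs_singleton Fh).
  apply: cvg_trans (hc : foldr (@partial R m) h l @ x --> _).
  have Fh' : {near x, foldr (@partial R m) h l =1 F}.
    by apply: filterS Fh => y ->.
  exact: (near_eq_cvg Fh').
move=> a; apply: near_eq_derivable (hd a).
by apply: (filterS _ Fh) => y ->.
Qed.

Lemma jac_germ m p (f h : 'rV[R]_m -> 'rV[R]_p) x :
  (\near x, f x = h x) -> jac f x = jac h x.
Proof.
move=> fh; apply/matrixP => a b; rewrite !mxE; apply: near_eq_derive.
by apply: filterS fh => y ->.
Qed.

Lemma rV_continuous (T : topologicalType) m (f : T -> 'rV[R]_m) :
  (forall j, continuous (fun x => f x 0 j)) -> continuous f.
Proof.
move=> fc x; apply/cvg_ballP => e e0.
have : forall j, \forall y \near x, ball (f x 0 j) e (f y 0 j).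
  by move=> j; have /cvg_ballP := fc j x; exact.
move/filter_forall; apply: filterS => y fy; split => // i j.
by rewrite ord1.
Qed.

End AffineMaps.

Section OTManifold.
Context {R : realType} {K : fieldExtType rat} {s t : nat}.
Context (sigma : 'I_(s + t + t) -> {rmorphism K -> R[i]}).
Context (s_gt0 : (0 < s)%N) (emb : embeddings_of_type sigma).
Context (U : set K) (adm : admissible sigma U).

Local Notation E := ('rV[R]_((s + t) + (s + t))).
Local Notation act := (ot_act sigma).
Local Notation M := (@ot_cover R s t).
Local Notation G := (ot_group U).

Let U_tpu : U `<=` totally_positive_unit sigma.
Proof. by case: adm. Qed.

Lemma ot_act_lshift g (z : E) j : act g z 0 (lshift (s + t) j) =
  affine2 (lshift (s + t) j) (rshift (s + t) j)
    (complex.Re (sigma (lshift t j) g.2)) (- complex.Im (sigma (lshift t j) g.2))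
    (complex.Re (sigma (lshift t j) g.1)) z.
Proof.
rewrite /ot_act /ofzcoord row_mxEl mxE /affine2 /zcoord.
by case: (sigma _ g.2) => a b; case: (sigma _ g.1) => c d /=; rewrite mulNr.
Qed.

Lemma ot_act_rshift g (z : E) j : act g z 0 (rshift (s + t) j) =
  affine2 (lshift (s + t) j) (rshift (s + t) j)
    (complex.Im (sigma (lshift t j) g.2)) (complex.Re (sigma (lshift t j) g.2))
    (complex.Im (sigma (lshift t j) g.1)) z.
Proof.
rewrite /ot_act /ofzcoord row_mxEr mxE /affine2 /zcoord.
case: (sigma _ g.2) => a b; case: (sigma _ g.1) => c d /=; ring.
Qed.

Lemma zcoord_act g (z : E) j : zcoord (act g z) j =
  sigma (lshift t j) g.2 * zcoord z j + sigma (lshift t j) g.1.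
Proof.
rewrite /zcoord ot_act_lshift ot_act_rshift /affine2.
case: (sigma _ g.2) => a b; case: (sigma _ g.1) => c d /=.
by apply/eqP; rewrite eq_complex /=; apply/andP; split; apply/eqP; ring.
Qed.

Lemma zcoord_inj (z w : E) : (forall j, zcoord z j = zcoord w j) -> z = w.
Proof.
move=> zw; apply/rowP => k; rewrite -(splitK k).
by case: (fintype.split k) => j /=; case: (zw j).
Qed.

Lemma ot_act_continuous g : continuous (act g).
Proof.
apply: rV_continuous => k; rewrite -(splitK k).
case: (fintype.split k) => j /=.
  by under eq_fun do rewrite ot_act_lshift; exact: affine2_continuous.
by under eq_fun do rewrite ot_act_rshift; exact: affine2_continuous.
Qed.

Lemma ot_act_smooth g b : smooth_on setT (fun z : E => act g z 0 b).
Proof.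
rewrite -(splitK b); case: (fintype.split b) => j /=.
  have -> := funext (fun z : E => ot_act_lshift g z j); exact: affine2_smooth.
have -> := funext (fun z : E => ot_act_rshift g z j); exact: affine2_smooth.
Qed.

Lemma ot_act_jac g z :
  let D f := diag_mx (\row_j (f (sigma (lshift t j) g.2) : R)) in
  jac (act g) z = block_mx (D (@complex.Re R)) (D (@complex.Im R))
                           (- D (@complex.Im R)) (D (@complex.Re R)).
Proof.
move=> D; apply/matrixP => a b; rewrite mxE /partial.
rewrite -[a]splitK -[b]splitK.
case: (fintype.split b) => j /=.
  rewrite (funext (fun z : E => ot_act_lshift g z j)).
  rewrite (@derive_val _ _ _ _ _ _ _ (affine2_is_derive _ _ _ _ _ _ _)).
  case: (fintype.split a) => i /=.
    rewrite block_mxEul !mxE /= !(inj_eq (@lshift_inj _ _)) eq_rlshift mulr0 addr0.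
    by rewrite eq_sym; case: eqP => [->|_]; rewrite ?mulr1 ?mulr0.
  rewrite block_mxEdl !mxE /= !(inj_eq (@rshift_inj _ _)) eq_lrshift mulr0 add0r.
  by rewrite eq_sym; case: eqP => [->|_]; rewrite ?mulr1 ?mulr0 ?mulr0n ?oppr0.
rewrite (funext (fun z : E => ot_act_rshift g z j)).
rewrite (@derive_val _ _ _ _ _ _ _ (affine2_is_derive _ _ _ _ _ _ _)).
case: (fintype.split a) => i /=.
  rewrite block_mxEur !mxE /= !(inj_eq (@lshift_inj _ _)) eq_rlshift mulr0 addr0.
  by rewrite eq_sym; case: eqP => [->|_]; rewrite ?mulr1 ?mulr0.
rewrite block_mxEdr !mxE /= !(inj_eq (@rshift_inj _ _)) eq_lrshift mulr0 add0r.
by rewrite eq_sym; case: eqP => [->|_]; rewrite ?mulr1 ?mulr0.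
Qed.

Lemma ot_act_holo g z : Jmx (s + t) *m jac (act g) z = jac (act g) z *m Jmx (s + t).
Proof.
rewrite ot_act_jac /Jmx !mulmx_block.
by rewrite !mul0mx !mulmx0 !mul1mx !mulmx1 !mulNmx !mulmxN !mul1mx !mulmx1 ?opprK
  ?add0r ?addr0.
Qed.

Lemma ot_group1 : G (0, 1).
Proof. by split; [exact: (mxpoly.integral0 (intr : {rmorphism int -> K}))|case: adm => _ []]. Qed.

Lemma ot_act1 z : act (0, 1) z = z.
Proof. by apply: zcoord_inj => j; rewrite zcoord_act rmorph0 rmorph1 mul1r addr0. Qed.

Lemma ot_groupM g h : G g -> G h -> G (g.1 + g.2 * h.1, g.2 * h.2).
Proof.
move=> [g1 g2] [h1 h2]; split; last by case: adm => _ [_ + _] _ _ _; exact.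
apply: integral_add => //; apply: integral_mul => //.
by have [] := U_tpu g2.
Qed.

Lemma ot_actM g h z :
  act (g.1 + g.2 * h.1, g.2 * h.2) z = act g (act h z).
Proof.
apply: zcoord_inj => j; rewrite !zcoord_act /= rmorphD !rmorphM /=; ring.
Qed.

Lemma ot_groupV g : G g -> G (- (g.2^-1 * g.1), g.2^-1).
Proof.
move=> [g1 g2]; split; last by case: adm => _ [_ _ +] _ _ _; exact.
apply: integral_opp; apply: integral_mul => //.
by have [] := U_tpu g2.
Qed.

Lemma ot_actVK g z : G g -> act (- (g.2^-1 * g.1), g.2^-1) (act g z) = z.
Proof.
move=> [g1 g2]; have [u0 _ _ _] := U_tpu g2.
rewrite -ot_actM /= mulVf // addrC subrr; exact: ot_act1.
Qed.


Lemma sigma_real (j : 'I_s) x :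
  complex.Im (sigma (lshift t (lshift t j)) x) = 0.
Proof.
case: emb => _ _ /(_ j x) + _ _; rewrite realE !lecE.
by case/orP => /andP[/eqP].
Qed.

Lemma Im_act g (z : E) (j : 'I_s) : G g ->
  complex.Im (zcoord (act g z) (lshift t j)) =
  complex.Re (sigma (lshift t (lshift t j)) g.2) * complex.Im (zcoord z (lshift t j)).
Proof.
move=> _; rewrite zcoord_act.
have := sigma_real j g.2; have := sigma_real j g.1.
case: (sigma _ g.2) => a b; case: (sigma _ g.1) => c d /= -> ->; ring.
Qed.

Lemma ot_act_cover g z : G g -> M z -> M (act g z).
Proof.
move=> Gg Mz j; rewrite Im_act // mulr_gt0 //.
by have [_ _ _ /(_ j)] := U_tpu Gg.2; rewrite ltcE => /andP[].
Qed.

Lemma ot_act_free g z : G g -> M z -> act g z = z -> g = (0, 1).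
Proof.
move=> Gg Mz gz; pose j := Ordinal s_gt0.
have y0 : complex.Im (zcoord z (lshift t j)) != 0 by rewrite gt_eqF //; exact: Mz.
have g2 : g.2 = 1.
  apply: (fmorph_inj (sigma (lshift t (lshift t j)))); rewrite rmorph1.
  apply/eqP; rewrite eq_complex sigma_real /= eqxx andbT; apply/eqP.
  by apply: (mulIf y0); rewrite -Im_act // gz mul1r.
have g1 : g.1 = 0.
  apply: (fmorph_inj (sigma (lshift t (lshift t j)))); rewrite rmorph0.
  have := zcoord_act g z (lshift t j); rewrite gz g2 rmorph1 mul1r => gE.
  by apply: (addrI (zcoord z (lshift t j))); rewrite addr0 -gE.
by case: g g1 g2 {Gg gz} => /= ? ? -> ->.
Qed.

Lemma ot_cover_open : open M.
Proof.
rewrite openE => z Mz.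
apply: (@filter_forall _ _
  (fun j (y : E) => 0 < complex.Im (zcoord y (lshift t j))) (nbhs z)) => j.
apply: (@coord_continuous R _ _ 0 (rshift (s + t) (lshift t j)) z [set x | 0 < x]).
by apply: open_nbhs_nbhs; split; [exact: open_gt|exact: Mz].
Qed.

Lemma ot_ball (z : E) : M z ->
  exists2 r : R, 0 < r & closed_ball z r `<=` M /\ compact (closed_ball z r).
Proof.
move=> Mz; have /nbhs_closedballP[r rM] : nbhs z M.
  by apply: open_nbhs_nbhs; split => //; exact: ot_cover_open.
exists r%:num => //; split => //.
apply: bounded_closed_compact; last exact: closed_ball_closed.
exists (`|z| + r%:num); split; first exact: num_real.
move=> x xr w; rewrite closed_ballE // /closed_ball_ /= => zw.
rewrite -[w](subKr z); apply: (le_trans (ler_normB _ _)); apply: ltW.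
by apply: le_lt_trans xr; rewrite lerD2l.
Qed.

Lemma ot_separate (z w : E) : M z -> M w ->
  exists V V' : set E, [/\ open V /\ open V', V z /\ V' w, V `<=` M /\ V' `<=` M &
    forall g v, G g -> V v -> V' (act g v) -> act g z = w].
Proof.
move=> Mz Mw; have [r r0 [rM rc]] := ot_ball Mz; have [q q0 [qM qc]] := ot_ball Mw.
pose C := closed_ball z r `|` closed_ball w q.
have CM : C `<=` M by move=> x [/rM|/qM].
have [_ _ _ /(_ C (compactU rc qc) CM) + _] := adm.
move=> /finite_seqP[sq sqE].
have : \forall p \near (z, w), forall g, g \in sq -> act g z <> w -> act g p.1 <> p.2.
  elim: sq {sqE} => [|g sq IH]; first by apply: filterE => p g.
  suff Hg : \forall p \near (z, w), act g z <> w -> act g p.1 <> p.2.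
    apply: filterS2 Hg IH => p Hg IH h; rewrite inE => /orP[/eqP->//|]; exact: IH.
  have [->|gzw] := eqVneq (act g z) w; first by apply: filterE => p.
  have := @norm_hausdorff R E; rewrite open_hausdorff.
  move=> /(_ (act g z) w gzw) [[A B] /= [Az Bw] [oA oB /eqP AB]].
  exists (act g @^-1` A, B) => /=.
    split; last by apply: open_nbhs_nbhs; split => //; exact: set_mem.
    apply: ot_act_continuous; apply: open_nbhs_nbhs; split => //; exact: set_mem.
  move=> [x y] /= [Ax By] _ xy.
  by have : (A `&` B) y; [split => //; rewrite -xy|rewrite AB].
move=> [[P Q] /= [Pz Qw] PQ].
exists (P° `&` (closed_ball z r)°), (Q° `&` (closed_ball w q)°); split.
- by split; apply: openI; exact: open_interior.
- by split; split => //; rewrite interior_closed_ballE //; exact: ballxx.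
- by split => x [_ /interior_subset]; [exact: rM|exact: qM].
move=> g v Gg [/interior_subset Pv /interior_subset Cv].
move=> [/interior_subset Qgv /interior_subset Cgv].
apply: contrapT => gzw; apply: (PQ (v, act g v) (conj Pv Qgv) g _ gzw) => //.
suff : [set` sq] g by [].
rewrite -sqE; split => //; exists (act g v); split; last by right.
by exists v => //; left.
Qed.

Lemma ot_orbit_refl (z : E) : ot_orbit sigma U z z.
Proof. by exists (0, 1); [exact: ot_group1|rewrite ot_act1]. Qed.

Lemma ot_orbit_act g (z : E) : G g -> ot_orbit sigma U (act g z) = ot_orbit sigma U z.
Proof.
move=> Gg; apply/seteqP; split => _ [h Gh <-].
  by exists (h.1 + h.2 * g.1, h.2 * g.2); [exact: ot_groupM|rewrite ot_actM].
rewrite -[X in act h X](ot_actVK z Gg) -ot_actM.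
eexists; last by [].
exact: ot_groupM Gh (ot_groupV Gg).
Qed.

Lemma ot_orbitP (z w : E) : ot_orbit sigma U z = ot_orbit sigma U w ->
  exists2 g, G g & act g z = w.
Proof. by move=> zw; have := ot_orbit_refl w; rewrite -zw. Qed.

Lemma ot_slice (z : E) (A : set E) : M z -> open A -> A z ->
  exists V : set E, [/\ open V, V z, V `<=` A, V `<=` M &
    {in V &, injective (ot_orbit sigma U)}].
Proof.
move=> Mz oA Az.
have [V [V' [[oV oV'] [Vz V'z] [VM _] VV']]] := ot_separate Mz Mz.
exists (V `&` V' `&` A); split.
- by do 2?apply: openI.
- by split.
- exact: subIsetr.
- by move=> x [[/VM]].
move=> x y /set_mem[[Vx V'x] _] /set_mem[[Vy V'y] _] /ot_orbitP[g Gg gxy].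
rewrite -gxy in V'y; have /(ot_act_free Gg Mz) g1 := VV' _ _ Gg Vx V'y.
by rewrite -gxy g1 ot_act1.
Qed.

Section Chart.
Context (V : set E) (VM : V `<=` M) (Vinj : {in V &, injective (ot_orbit sigma U)}).
Local Notation c := (ot_chart sigma U V).

Lemma ot_cmapK z : V z -> cmap c (ot_orbit sigma U z) = z.
Proof.
move=> Vz; apply: get_unique; first by split => //; exact: ot_orbit_refl.
by move=> y [[g Gg <-] Vgz]; apply: Vinj; rewrite ?inE // ot_orbit_act.
Qed.

Lemma ot_ccod : ccod c = V.
Proof.
apply/seteqP; split => [_ [_ [z Vz <-] <-]|z Vz]; first by rewrite ot_cmapK.
by exists (ot_orbit sigma U z); [exists z|rewrite ot_cmapK].
Qed.

End Chart.

Lemma ot_overlap V V' :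
  {in V &, injective (ot_orbit sigma U)} ->
  overlap (ot_chart sigma U V) (ot_chart sigma U V') =
  V `&` \bigcup_(g in G) (act g @^-1` V').
Proof.
move=> Vinj; apply/seteqP; split.
  move=> _ [_ [[z Vz <-] [w Vw /esym/ot_orbitP[g Gg gz]]] <-].
  by rewrite ot_cmapK //; split => //; exists g => //=; rewrite gz.
move=> z [Vz [g Gg Vgz]]; exists (ot_orbit sigma U z); last by rewrite ot_cmapK.
by split; [exists z|exists (act g z) => //; rewrite ot_orbit_act].
Qed.

Lemma ot_overlap_open c c' : ot_atlas sigma U c -> ot_atlas sigma U c' ->
  open (overlap c c').
Proof.
move=> [V [oV _ Vi ->]] [V' [oV' _ Vi' ->]]; rewrite ot_overlap //.
apply: openI => //; apply: bigcup_open => g _.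
by apply: open_comp => // x _; exact: ot_act_continuous.
Qed.

Lemma ot_transition c c' x : ot_atlas sigma U c -> ot_atlas sigma U c' ->
  overlap c c' x ->
  exists2 g, G g & \forall y \near x, transition c c' y = act g y.
Proof.
move=> [V [oV _ Vi ->]] [V' [oV' _ Vi' ->]]; rewrite ot_overlap //.
move=> [Vx [g Gg Vgx]]; exists g => //.
have gV' : nbhs (act g x) V' by apply: open_nbhs_nbhs.
have xV' : nbhs x (act g @^-1` V') by exact: (@ot_act_continuous g x _ gV').
apply: (@filterS _ (nbhs x) _ _ _ _ xV') => y V'y.
by rewrite /transition /= -(ot_orbit_act y Gg) -[RHS](ot_cmapK Vi' V'y).
Qed.

Lemma ot_atlas_cover :
  \bigcup_(c in ot_atlas sigma U) cdom c = ot_orbit sigma U @` M.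
Proof.
apply/seteqP; split => [x [_ [V [_ VM _ ->]] [z /VM Mz <-]] | _ [z Mz <-]].
  by exists z.
have [V [oV Vz _ VM Vi]] := ot_slice Mz ot_cover_open Mz.
by exists (ot_chart sigma U V); [exists V|exists z].
Qed.

Lemma ot_chartK c : ot_atlas sigma U c ->
  forall x, cdom c x -> cinv c (cmap c x) = x.
Proof. by move=> [V [_ _ Vi ->]] _ [z Vz <-]; rewrite ot_cmapK. Qed.

Lemma ot_transition_holomorphic c c' :
  ot_atlas sigma U c -> ot_atlas sigma U c' ->
  holomorphic_on (overlap c c') (transition c c').
Proof.
move=> ac ac'; split => [b|x xo].
  apply: smooth_on_germ => x xo; have [g _ xg] := ot_transition ac ac' xo.
  exists (fun z => act g z 0 b); first exact: ot_act_smooth.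
  by apply: filterS xg => y ->.
have [g _ xg] := ot_transition ac ac' xo.
by rewrite (jac_germ xg) ot_act_holo.
Qed.

Lemma ot_hausdorff x y : (ot_orbit sigma U @` M) x -> (ot_orbit sigma U @` M) y ->
  x <> y ->
  exists c c' (A A' : set E),
    [/\ ot_atlas sigma U c /\ ot_atlas sigma U c', cdom c x /\ cdom c' y,
        [/\ open A, A `<=` ccod c & A (cmap c x)],
        [/\ open A', A' `<=` ccod c' & A' (cmap c' y)] &
        (cinv c @` A) `&` (cinv c' @` A') = set0].
Proof.
move=> [z Mz <-] [w Mw <-] zw.
have [V [V' [[oV oV'] [Vz V'w] _ VV']]] := ot_separate Mz Mw.
have [B [oB Bz BV BM Bi]] := ot_slice Mz oV Vz.
have [B' [oB' Bw BV' BM' Bi']] := ot_slice Mw oV' V'w.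
exists (ot_chart sigma U B), (ot_chart sigma U B'), B, B'; split.
- by split; [exists B|exists B'].
- by split; [exists z|exists w].
- by split; rewrite ?ot_ccod ?ot_cmapK.
- by split; rewrite ?ot_ccod ?ot_cmapK.
apply/seteqP; split => // _ [[v /BV Vv <-] [v' /BV' V'v' /esym/ot_orbitP]].
move=> [g Gg gv]; apply: zw; rewrite -(ot_orbit_act z Gg); congr ot_orbit.
by apply: VV' Gg Vv _; rewrite gv.
Qed.

(* X(K, U): its points are the orbits in H^s x C^t, and its charts are the local
   inverses of the quotient map. *)
Definition OT_manifold : complexManifold R (s + t) :=
  ComplexManifold ot_atlas_cover ot_chartK ot_overlap_open
    ot_transition_holomorphic ot_hausdorff.

End OTManifold.

(* Main.v *)
(** Let W = omega^(n-1) and del W = delbar al.  With y_0 the imaginary part of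
    the first coordinate, the invariant form dzbar_0 / y_0 is delbar-closed and
    del (dzbar_0 / y_0) is a positive multiple of i dz_0 /\ dzbar_0 / y_0^2.  By
    Stokes' theorem on X(K, U), the integral of del (dzbar_0 / y_0) /\ W equals,
    up to sign, that of (dzbar_0 / y_0) /\ delbar al, which is zero; but the
    first integrand is positive.

    Integration over X(K, U) is replaced by averaging over large boxes in
    H^s x C^t.  In the coordinates log y_j (and the real coordinates x_j and
    those of C^t) the primitive (dzbar_0 / y_0) /\ (W - al) becomes a vector
    field whose divergence is bounded below by some c > 0.  Its components along
    the log y_j are bounded, being invariant under O_K x| U (here one uses that
    units have norm one); the other components are bounded on each strip
    0 <= log y_j <= T, because only finitely many units are needed to move the
    strip into a compact set.  On a box of side T along the log y_j and of a far
    larger side along the other coordinates, this contradicts the divergence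
    theorem. *)

Require Import Defs.
From HB Require Import structures.
From mathcomp Require Import all_boot all_order all_algebra all_field.
From mathcomp Require Import complex ring lra.
From mathcomp Require Import all_classical all_reals all_analysis.

Set Implicit Arguments.
Unset Strict Implicit.
Unset Printing Implicit Defensive.

Import Order.TTheory GRing.Theory Num.Theory.
Import numFieldNormedType.Exports.

Local Open Scope classical_set_scope.
Local Open Scope ring_scope.

(** * Norms of units *)

(** Without the factor 1/y_0 the vector field is divergence-free: its divergence is a single
    coefficient of del W = delbar al, up to a constant. All of the positivity comes from
    differentiating 1/y_0. The resulting lower bound is uniform because the differentiated term is
    an invariant function, so its extrema over the cover are attained on a compact set.

    The order in which the two sides of the box are chosen is forced. A unit multiplies the
    components along the real parts and along C^t by its embeddings, so these components are bounded
    only on a strip, and the bound depends on the height T of that strip. Hence T is fixed first,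
    from the global bounds on the log components and from c. The other side follows, large enough to
    make the strip bound harmless.

    Boxes on the cover need no integration on the quotient, and the divergence theorem enters only
    as a pointwise inequality: somewhere in the box the divergence is at most the mean flux. Norm
    one enters through the top-degree monomial, whose multiplier is the norm times the product of
    the real embeddings; this is what the product of the y_j compensates. *)

Section PrimitiveElement.
Variables (C : numClosedFieldType) (K : fieldExtType rat).

Lemma primitive_element : exists theta : K,
  forall x, exists q : {poly rat}, x = (map_poly (in_alg K) q).[theta].
Proof.
exists (separable_generator 1%AS fullv) => x.
have sep : separable 1%AS (fullv : {vspace K}).
  apply/separableP => y _; apply: pcharf0_separable => p.
  by rewrite (fmorph_pchar (in_alg K)) pchar_num.
have xin : x \in <<1; separable_generator 1%AS fullv>>%VS.
  by rewrite -(eq_adjoin_separable_generator sep (sub1v _)) memvf.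
have /polyOver1P[q qE] := Fadjoin_polyOver 1%AS (separable_generator 1%AS fullv)
  x.
by exists q; rewrite -qE (Fadjoin_poly_eq xin).
Qed.

Lemma rational_minPoly (theta : K) : exists p : {poly rat},
  [/\ p \is monic, separable_poly p, root (map_poly (in_alg K) p) theta &
  forall q : {poly rat}, (map_poly (in_alg K) q).[theta] = 0 -> p %| q].
Proof.
have /polyOver1P[p pE] := minPolyOver 1%AS theta.
exists p; split.
- by rewrite -(map_monic (in_alg K)) -pE monic_minPoly.
- rewrite -(separable_map (in_alg K)) -pE.
  by apply: pcharf0_separable => r; rewrite (fmorph_pchar (in_alg K)) pchar_num.
- by rewrite -pE root_minPoly.
move=> q q0; rewrite -(dvdp_map (in_alg K)) -pE; apply: minPoly_dvdp.
  exact: alg_polyOver.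
exact/rootP.
Qed.

(** The embedding evaluates at [r] any polynomial representing an element at [theta]. Two
    representatives differ by a multiple of [p], so the choice does not matter ([fE]), and the ring
    morphism laws follow. *)
Lemma embedding_of_root (theta : K) (p : {poly rat}) (r : C) :
    (forall x, exists q : {poly rat}, x = (map_poly (in_alg K) q).[theta]) ->
    (forall q : {poly rat}, (map_poly (in_alg K) q).[theta] = 0 -> p %| q) ->
    root (map_poly ratr p) r ->
  exists f : {rmorphism K -> C}, f theta = r.
Proof.
move=> gen minp rp.
have gen' x : exists q : {poly rat}, x == (map_poly (in_alg K) q).[theta].
  by have [q ->] := gen x; exists q.
pose Q x := xchoose (gen' x).
have QE x : x = (map_poly (in_alg K) (Q x)).[theta]
  by exact/eqP/(xchooseP (gen' x)).
pose f x := (map_poly ratr (Q x)).[r].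
have fE (q : {poly rat}) : f (map_poly (in_alg K) q).[theta] =
  (map_poly ratr q).[r].
  apply/eqP; rewrite -subr_eq0 -hornerN -hornerD -rmorphN -rmorphD /=.
  have /minp : (map_poly (in_alg K)
    (Q (map_poly (in_alg K) q).[theta] - q)).[theta] = 0.
    by rewrite rmorphB hornerD hornerN -QE subrr.
  rewrite -(dvdp_map (@ratr C)) => /dvdpP[h ->].
  by rewrite hornerM (rootP rp) mulr0.
have fB : zmod_morphism f.
  move=> x y; rewrite {1}(QE x) {1}(QE y) -hornerN -hornerD -rmorphB /= fE.
  by rewrite rmorphB hornerD hornerN.
have fM : monoid_morphism f.
  split; last by move=> x y; rewrite {1}(QE x) {1}(QE y) -hornerM -rmorphM /=
    fE rmorphM hornerM.
  have {1}-> : 1 = (map_poly (in_alg K) 1).[theta] by rewrite rmorph1 hornerE.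
  by rewrite fE rmorph1 hornerE.
pose fA := GRing.isZmodMorphism.Build K C f fB.
pose fR := GRing.isMonoidMorphism.Build K C f fM.
pose F : {rmorphism K -> C} := HB.pack f fA fR.
have gX : (map_poly (in_alg K) 'X).[theta] = theta by rewrite map_polyX hornerX.
by exists F; rewrite -[LHS]/(f theta) -{1}gX fE map_polyX hornerX.
Qed.

(* Split q into linear factors: det (A - b) is, up to sign, the value at b of
   the characteristic polynomial of A. *)
Lemma det_horner_mx n (A : 'M[C]_n.+1) (rs : seq C) (q : {poly C}) :
  char_poly A = \prod_(r <- rs) ('X - r%:P) ->
  \det (horner_mx A q) = \prod_(r <- rs) q.[r].
Proof.
move=> Ars; have [bs ->] := closed_field_poly_normal q.
have srs : size rs = n.+1.
  by apply: succn_inj; rewrite -(size_prod_XsubC rs id) -Ars size_char_poly.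
rewrite linearZ detZ /= rmorph_prod /= (big_morph _ (@detM _ _) (det1 _ _)).
under eq_bigr do rewrite rmorphB /= horner_mx_X horner_mx_C.
under [RHS]eq_bigr do rewrite hornerZ horner_prod.
rewrite big_split /= big_const_seq count_predT srs -Monoid.iteropE /=;
  congr (_ * _).
rewrite exchange_big; apply: eq_bigr => b _ /=.
have -> : A - b%:M = - (b%:M - A) by rewrite opprB.
rewrite -scaleN1r detZ.
have -> : \det (b%:M - A) = (char_poly A).[b].
  rewrite /char_poly -horner_evalE -det_map_mx; congr (\det _).
  apply/matrixP => i j; rewrite !mxE /= horner_evalE hornerD hornerN hornerC.
  by rewrite hornerMn hornerX.
have -> : (-1) ^+ n.+1 = \prod_(r <- rs) (-1) :> C.
  by rewrite big_const_seq count_predT srs -Monoid.iteropE.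
rewrite Ars horner_prod -big_split /=.
by apply: eq_bigr => r _; rewrite !hornerE mulN1r opprB.
Qed.

(** The values of the embeddings at a primitive element are the roots of its minimal polynomial,
    each taken once. If [u] is [q] at that element, the product is therefore the determinant of [q]
    at the companion matrix, which has rational entries. *)
Lemma prod_embeddings_rat m (sigma : 'I_m -> {rmorphism K -> C}) u :
    (forall i j, sigma i =1 sigma j -> i = j) ->
    (forall tau : {rmorphism K -> C}, exists i, tau =1 sigma i) ->
  exists d : rat, \prod_i sigma i u = ratr d.
Proof.
move=> inj surj; have [theta gen] := primitive_element.
have [p [pm ps p0 minp]] := rational_minPoly theta.
have [q uE] := gen u.
have [rs /= rsE] := closed_field_poly_normal (map_poly ratr p : {poly C}).
have sE i (h : {poly rat}) : sigma i (map_poly (in_alg K) h).[theta] =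
    (map_poly ratr h).[sigma i theta].
  rewrite -horner_map -map_poly_comp; congr (_.[_]); apply: eq_map_poly => a /=.
  by rewrite alg_num_field fmorph_rat.
have rsu : uniq rs.
  rewrite -separable_prod_XsubC; move: ps;
    rewrite -(separable_map (@ratr C)) rsE.
  by rewrite (monicP _) ?scale1r // map_monic.
have mem_rs r : (r \in rs) = root (map_poly ratr p) r.
  by rewrite rsE (monicP _) ?scale1r ?root_prod_XsubC // map_monic.
have perm : perm_eq [seq sigma i theta | i <- enum 'I_m] rs.
  apply: uniq_perm => //.
    rewrite map_inj_in_uniq ?enum_uniq // => i j _ _ ij; apply: inj => x.
    by have [h ->] := gen x; rewrite !sE ij.
  move=> r; rewrite mem_rs; apply/mapP/idP.
    by move=> [i _ ->]; rewrite rootE -sE (rootP p0) rmorph0.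
  move=> /(embedding_of_root gen minp)[f fr]; have [i fi] := surj f.
  by exists i; rewrite ?mem_enum // -fi.
rewrite (eq_bigr (fun i => (map_poly ratr q).[sigma i theta])); last first.
  by move=> i _; rewrite uE sE.
rewrite -big_enum /= -(big_map (fun i => sigma i theta) xpredT
  (fun r => (map_poly ratr q).[r])).
rewrite (perm_big _ perm) /=.
(* [horner_mx] needs a matrix of positive size. Size zero is excluded because [p] would then be 1,
   which has no root. *)
have [n [A AE]] : exists n (A : 'M[rat]_n.+1), char_poly A = p.
  move: (companionmx p) (companionmxK pm); case: (_.-1) => [A|n A Ap];
    last by exists n, A.
  rewrite /char_poly det_mx00 => p1; move: p0.
  by rewrite -p1 rmorph1 rootE hornerE oner_eq0.
exists (\det (horner_mx A q)); rewrite -(@det_horner_mx _ (map_mx ratr A)).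
  by rewrite -det_map_mx map_horner_mx.
by rewrite -map_char_poly AE rsE (monicP _) ?scale1r // map_monic.
Qed.

(** The monic equation has integer coefficients, so it passes through [rat] from [C] to [algC],
    where rational algebraic integers are integers. *)
Lemma rat_integral_int (x : rat) : integralOver (intr : int -> C) (ratr x) ->
  exists m : int, x = m%:~R.
Proof.
move=> [p pm px]; have : (ratr x : algC) \is a Num.int.
  apply: Cint_rat_Aint; first by apply/CratP; exists x.
  apply: (@root_monic_Aint (map_poly intr p)); last 2 first.
  - by rewrite monic_map.
  - by apply/polyOverP => i; rewrite coef_map /= intr_int.
  have E (F : numClosedFieldType) : map_poly intr p = map_poly ratr
    (map_poly intr p : {poly rat}) :> {poly F}.
    by rewrite -map_poly_comp; apply: eq_map_poly => a /=; rewrite ratr_int.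
  by move: px; rewrite !E !fmorph_root.
move=> /intrP[m xm]; exists m; apply: (fmorph_inj (@ratr algC)).
by rewrite /= ratr_int -xm.
Qed.

Lemma integral_prod_embeddings m (sigma : 'I_m -> {rmorphism K -> C}) u :
    integralOver (intr : int -> K) u ->
  integralOver (intr : int -> C) (\prod_i sigma i u).
Proof.
move=> iu; elim/big_ind: _ => [|x y|i _].
- exact: (integral1 (intr : {rmorphism int -> C})).
- exact: (integral_mul (RtoK := (intr : {rmorphism int -> C}))).
have [p pm pu] := iu; exists p => //.
have -> : map_poly intr p = map_poly (sigma i) (map_poly intr p).
  by rewrite -map_poly_comp; apply: eq_map_poly => a /=; rewrite rmorph_int.
exact: rmorph_root.
Qed.

(** The norms of [u] and of its inverse are rational and integral, hence integers with product 1;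
    positivity excludes -1. *)
Lemma norm_unit m (sigma : 'I_m -> {rmorphism K -> C}) u :
    (forall i j, sigma i =1 sigma j -> i = j) ->
    (forall tau : {rmorphism K -> C}, exists i, tau =1 sigma i) ->
    u != 0 -> integralOver (intr : int -> K) u ->
    integralOver (intr : int -> K) u^-1 -> 0 < \prod_i sigma i u ->
  \prod_i sigma i u = 1.
Proof.
move=> inj surj u0 iu iu' pos.
have intN v : integralOver (intr : int -> K) v -> exists m : int,
  \prod_i sigma i v = m%:~R.
  move=> /(integral_prod_embeddings sigma);
    have [d ->] := prod_embeddings_rat v inj surj.
  by move=> /rat_integral_int[k ->]; exists k; rewrite ratr_int.
have [k kE] := intN _ iu; have [l lE] := intN _ iu'.
have : (k * l)%:~R = 1 :> C.
  rewrite intrM -kE -lE -big_split /= big1 // => i _.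
  by rewrite -rmorphM divff // rmorph1.
move: pos; rewrite kE ltr0z => k0 /eqP; rewrite -[1]/(1%:~R) eqr_int => /eqP kl.
have : k \is a GRing.unit by apply/unitrPr; exists l.
by case/orP => /eqP kE'; rewrite kE' // in k0 *.
Qed.

End PrimitiveElement.

(** * Divergence on boxes *)

Section DivergenceTheorem.
Context {R : realType} {m : nat}.
Implicit Types (x : 'rV[R]_m) (a : 'I_m) (r : R).

Definition upd x a r : 'rV[R]_m := \row_b (if b == a then r else x 0 b).

Lemma upd_upd x a r r' : upd (upd x a r) a r' = upd x a r'.
Proof. by apply/rowP => b; rewrite !mxE; case: eqP. Qed.

Lemma upd_id x a : upd x a (x 0 a) = x.
Proof. by apply/rowP => b; rewrite mxE; case: eqP => [->|]. Qed.

(** The factor N + 1 is spent on an extra index [i]. Exchanging [i] with [k a] is an involution on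
    the pairs, after which the inner sum over [i] runs along a whole grid line in direction [a] and
    telescopes; [phi k] is constant along that line by the first hypothesis. *)
Lemma sum_ffun_telescope N (phi : {ffun 'I_m -> 'I_N.+1} -> nat -> R)
    (a : 'I_m) (c : R) :
    (forall (k : {ffun 'I_m -> 'I_N.+1}) (i : 'I_N.+1),
       phi [ffun b => if b == a then i else k b] = phi k) ->
    (forall k, phi k N.+1 - phi k 0%N <= c) ->
  N.+1%:R * (\sum_(k : {ffun 'I_m -> 'I_N.+1}) (phi k (k a).+1 - phi k (k a)))
    <= #|{ffun 'I_m -> 'I_N.+1}|%:R * c.
Proof.
move=> phiE phic.
pose u (ki : {ffun 'I_m -> 'I_N.+1} * 'I_N.+1) :
    {ffun 'I_m -> 'I_N.+1} * 'I_N.+1 :=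
  ([ffun b => if b == a then ki.2 else ki.1 b], ki.1 a).
have uK : involutive u.
  move=> [k i]; rewrite /u /= ffunE eqxx; congr pair.
  by apply/ffunP => b; rewrite !ffunE; case: eqP => [->|].
pose G (k : {ffun 'I_m -> 'I_N.+1}) := phi k (k a).+1 - phi k (k a).
have -> : N.+1%:R * \sum_k G k = \sum_k \sum_(i < N.+1) G (u (k, i)).1.
  transitivity (\sum_(p : {ffun 'I_m -> 'I_N.+1} * 'I_N.+1) G p.1).
    rewrite -(pair_bigA _ (fun k i => G k)) /= mulr_sumr; apply: eq_bigr => k _.
    by rewrite sumr_const card_ord mulr_natl.
  by rewrite (reindex_inj (inv_inj uK))
    (pair_bigA _ (fun k i => G (u (k, i)).1)).
rewrite mulr_natl -sumr_const; apply: ler_sum => k _.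
apply: le_trans (phic k); rewrite -telescope_sumr // big_mkord.
by under eq_bigr do rewrite /G /= phiE !ffunE eqxx.
Qed.

Context (L C : 'I_m -> R) (f d : 'I_m -> 'rV[R]_m -> R).
Let box := [set x : 'rV[R]_m | forall a, 0 <= x 0 a <= L a].

Hypothesis L_gt0 : forall a, 0 < L a.
Hypothesis fd : forall a x, is_derive (x 0 a) 1 (fun r => f a (upd x a r))
  (d a x).
Hypothesis dc : forall a, continuous (d a).
Hypothesis fC : forall a x, box x -> `|f a x| <= C a.

(* The difference quotients of f a in direction a telescope over the grid, and
   the mean value theorem turns them into values of d a near the grid points. *)
Lemma grid_divergence N : exists x (xi : 'I_m -> 'rV[R]_m), [/\ box x,
  forall a b, `|xi a 0 b - x 0 b| <= L b / N.+1%:R &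
  \sum_a d a (xi a) <= \sum_a 2 * C a / L a].
Proof.
have N0 : 0 < N.+1%:R :> R by rewrite ltr0n.
pose node a i : R := L a * i%:R / N.+1%:R.
have nodeS a i : node a i.+1 - node a i = L a / N.+1%:R.
  by rewrite /node -natr1; field; rewrite gt_eqF.
pose pt (k : {ffun 'I_m -> 'I_N.+1}) : 'rV[R]_m := \row_a node a (k a).
have nodeb a i : (i <= N.+1)%N -> 0 <= node a i <= L a.
  move=> iN; rewrite divr_ge0 ?mulr_ge0 ?ler0n ?(ltW (L_gt0 a)) //=.
  by rewrite ler_pdivrMr // ler_pM2l // ler_nat.
have ptb k : box (pt k) by move=> a; rewrite mxE nodeb // ltnW.
have updb k a i : (i <= N.+1)%N -> box (upd (pt k) a (node a i)).
  by move=> iN b; rewrite mxE; case: eqP => [->|_]; [exact: nodeb|exact: ptb].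
have mvt (k : {ffun 'I_m -> 'I_N.+1}) a : exists c,
    node a (k a) <= c <= node a (k a).+1 /\
    f a (upd (pt k) a (node a (k a).+1)) - f a (upd (pt k) a (node a (k a))) =
    d a (upd (pt k) a c) * (L a / N.+1%:R).
  have lt : node a (k a) < node a (k a).+1.
    by rewrite -subr_gt0 nodeS divr_gt0.
  have fd' r : is_derive r 1 (fun r => f a (upd (pt k) a r))
    (d a (upd (pt k) a r)).
    have := fd a (upd (pt k) a r); rewrite mxE eqxx.
    by under eq_fun do rewrite upd_upd.
  have [|c cab ->] := MVT lt (fun r _ => fd' r).
    apply: derivable_within_continuous => r _;
      exact: (@ex_derive _ _ _ _ _ _ _ (fd' r)).
  by exists c; rewrite nodeS; split => //; rewrite !ltW ?(itvP cab).
have {mvt}/choice[c cE] (k : {ffun 'I_m -> 'I_N.+1}) :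
    exists c : 'I_m -> R, forall a,
    node a (k a) <= c a <= node a (k a).+1 /\
    f a (upd (pt k) a (node a (k a).+1)) - f a (upd (pt k) a (node a (k a))) =
    d a (upd (pt k) a (c a)) * (L a / N.+1%:R).
  by have [c cE] := choice (mvt k); exists c.
pose xi (k : {ffun 'I_m -> 'I_N.+1}) a := upd (pt k) a (c k a).
(* Pigeonhole over the cells: if every cell violated the bound, the sum over all cells would violate
   it too. *)
suff /existsP[k kS] : [exists k, \sum_a d a (xi k a) <= \sum_a 2 * C a / L a].
  exists (pt k), (xi k); split => // a b; rewrite mxE; case: eqP => [->|_].
    have [/andP[c1 c2] _] := cE k a; rewrite mxE ger0_norm ?subr_ge0 //.
    by rewrite -(nodeS a (k a)) lerD2r.
  by rewrite subrr normr0 divr_ge0 // ltW.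
apply/contraT; rewrite negb_exists => /forallP lt.
pose k0 : {ffun 'I_m -> 'I_N.+1} := [ffun=> ord0].
suff : \sum_(k : {ffun 'I_m -> 'I_N.+1}) \sum_a d a (xi k a) <=
       \sum_(k : {ffun 'I_m -> 'I_N.+1}) \sum_a 2 * C a / L a.
  rewrite leNgt => /negP[]; rewrite (bigD1 k0) //= [ltRHS](bigD1 k0) //=.
  by apply: ltr_leD; [rewrite ltNge lt|apply: ler_sum => k _;
    rewrite ltW // ltNge lt].
rewrite exchange_big /= [leRHS]exchange_big /=; apply: ler_sum => a _.
rewrite sumr_const -[leRHS]mulr_natl.
(* The telescoped difference compares two opposite faces, each contributing at most [C a]; this is
   the origin of [2 * C a]. *)
pose phi (k : {ffun 'I_m -> 'I_N.+1}) i := f a (upd (pt k) a (node a i)).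
have := @sum_ffun_telescope N phi a (2 * C a) _ _.
have -> : \sum_(k : {ffun 'I_m -> 'I_N.+1}) (phi k (k a).+1 - phi k (k a)) =
  (L a / N.+1%:R) * \sum_k d a (xi k a).
  by rewrite mulr_sumr; apply: eq_bigr => k _; rewrite /phi (cE k a).2 mulrC.
rewrite mulrA mulrCA divff ?gt_eqF // mulr1 => H; rewrite mulrA ler_pdivlMr //.
rewrite mulrC; apply: H => [k i|k].
  apply/funext => j; rewrite /phi; congr f; apply/rowP => b.
  by rewrite !mxE ffunE; case: eqP.
apply: le_trans (ler_norm _) _; apply: le_trans (ler_normB _ _) _.
by rewrite mulr_natl mulr2n; apply: lerD; apply: fC; exact: updb.
Qed.

(** The mean of the divergence over the box is the flux divided by the volume, so somewhere the
    divergence is no larger. Such a point is found as a cluster point of the grid points when the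
    mesh tends to zero. *)
Lemma box_divergence : exists2 x, box x & \sum_a d a x <= \sum_a 2 * C a / L a.
Proof.
have [x_ /choice[xi xP]] := choice grid_divergence.
have cbox : compact box.
  have := @rV_compact R m (fun a => `[0, L a]%classic)
    (fun a => @segment_compact R 0 (L a)).
  by congr (compact _); apply/seteqP; split => x /= xb a; have := xb a;
    rewrite in_itv.
have [|x [bx clx]] := cbox (x_ @ \oo) _.
  by exists 0%N => // N _; have [] := xP N.
exists x => //; rewrite leNgt; apply/negP => lt.
have [e e0 he] : exists2 e : R, 0 < e & forall y : 'I_m -> 'rV[R]_m,
    (forall a, ball x e (y a)) -> \sum_a 2 * C a / L a < \sum_a d a (y a).
  pose eta := \sum_a d a x - \sum_a 2 * C a / L a.
  have eta0 : 0 < eta by rewrite subr_gt0.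
  (* The slack [eta] is shared among [m] coordinates; dividing by m + 1 keeps the final inequality
     strict and also covers m = 0. *)
  have : \forall y \near x, forall a, d a x - eta / m.+1%:R < d a y.
    apply: (@filter_forall _ _ (fun a y => d a x - eta / m.+1%:R < d a y)
      (nbhs x)) => a.
    apply: (@dc a x [set r | d a x - eta / m.+1%:R < r]).
    apply: open_nbhs_nbhs; split; first exact: open_gt.
    by rewrite /= ltrBlDr ltrDl divr_gt0.
  move=> /nbhs_ballP[e /= e0 he]; exists e => // y xy.
  have le : \sum_a (d a x - eta / m.+1%:R) <= \sum_a d a (y a).
    by apply: ler_sum => a _; apply/ltW/(he (y a) (xy a) a).
  apply: lt_le_trans le; rewrite sumrB sumr_const card_ord.
  rewrite -[ltLHS](subKr (\sum_a d a x)) -/eta ltrD2l ltrN2 -[ltLHS]mulr_natr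
    -mulrA.
  by rewrite gtr_pMr // mulrC ltr_pdivrMr // mul1r ltr_nat.
(* One half of [e] is for the distance from [x] to the grid point, the other for the distance from
   the grid point to the points supplied by the mean value theorem. *)
have [N0 N0P] : exists N0 : nat, forall b, L b / N0.+1%:R < e / 2.
  exists (Num.bound (\sum_b L b / (e / 2))) => b.
  rewrite ltr_pdivrMr // mulrC -ltr_pdivrMr ?divr_gt0 //.
  apply: (@le_lt_trans _ _ (\sum_b L b / (e / 2))).
    rewrite (bigD1 b) //= lerDl sumr_ge0 // => i _.
    by rewrite divr_ge0 ?(ltW (L_gt0 _)) // divr_ge0 // ltW.
  apply: (lt_trans (archi_boundP _)); last by rewrite ltr_nat.
  by rewrite sumr_ge0 // => i _;
    rewrite divr_ge0 ?(ltW (L_gt0 _)) // divr_ge0 // ltW.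
have big : (x_ @ \oo) [set y | exists2 N, (N0 <= N)%N & y = x_ N].
  by exists N0 => // N /= N0N; exists N.
have e2 : 0 < e / 2 by rewrite divr_gt0.
have [_ [[N N0N ->] xN]] := clx _ _ big (nbhsx_ballx x _ e2).
have [_ xiN] := xP N; rewrite leNgt => /negP[]; apply: he => a.
have xNxi : ball (x_ N) (e / 2) (xi N a).
  split=> // i b; rewrite ord1 /ball /= distrC; apply: le_lt_trans (xiN a b) _.
  apply: le_lt_trans (N0P b);
    rewrite ler_pM2l // lef_pV2 ?posrE ?ltr0n // ler_nat.
  by rewrite ltnS.
by have := ball_triangle xN xNxi; rewrite -splitr.
Qed.

End DivergenceTheorem.

(** * Exterior forms at a point *)

Section Wedge.
Context {R : realType} {n : nat}.
Local Notation I := 'I_(n + n).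
Implicit Types (a b : ext R n) (A B C : {set I}).

Lemma shuffle_sign1 (k : I) B :
  shuffle_sign (R := R) [set k]%SET B = (-1) ^+ #|[set l in B | (l < k)%N]%SET|.
Proof.
congr (_ ^+ _); rewrite -[RHS](card_imset _
  (fun l l' (e : (k, l) = (k, l')) => congr1 snd e)).
apply: eq_card => -[x y]; rewrite !inE /=; apply/and3P/imsetP => /=.
  by move=> [/eqP-> yB yk]; exists y; rewrite ?inE ?yB.
by move=> [l + [-> ->]]; rewrite inE => /andP[].
Qed.

Lemma wedge_covec (k : I) b C : wedge (covec k) b C =
  (k \in C)%:R * shuffle_sign [set k]%SET (C :\ k)%SET * b (C :\ k)%SET.
Proof.
rewrite ffunE; case: (boolP (k \in C)) => kC; last first.
  rewrite !mul0r big1 // => A AC; rewrite ffunE; case: eqP => [AE|];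
    last by rewrite mulr0 mul0r.
  by move: kC; rewrite -finset.sub1set -AE AC.
rewrite (bigD1 [set k]%SET) ?finset.sub1set //= big1 ?addr0.
  by rewrite ffunE eqxx mulr1 mul1r.
by move=> A /andP[_ /negPf AE]; rewrite ffunE AE mulr0 mul0r.
Qed.

Lemma wedge_suml (T : finType) (f : T -> ext R n) b :
  wedge (\sum_i f i) b = \sum_i wedge (f i) b.
Proof.
apply/ffunP => C; rewrite sum_ffunE ffunE.
under [RHS]eq_bigr do rewrite ffunE.
rewrite exchange_big /=; apply: eq_bigr => A _.
by rewrite sum_ffunE mulr_sumr mulr_suml.
Qed.

Lemma wedge_sumr (T : finType) (f : T -> ext R n) a :
  wedge a (\sum_i f i) = \sum_i wedge a (f i).
Proof.
apply/ffunP => C; rewrite sum_ffunE ffunE.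
under [RHS]eq_bigr do rewrite ffunE.
by rewrite exchange_big /=; apply: eq_bigr => A _; rewrite sum_ffunE mulr_sumr.
Qed.

Lemma wedgeZl (c : R[i]) a b : wedge (c *: a) b = c *: wedge a b.
Proof.
apply/ffunP => C; rewrite !ffunE /= scaler_sumr; apply: eq_bigr => A _.
by rewrite ffunE -[in LHS]mulrA mulrCA -!mulrA; congr (_ * _); rewrite mulrCA.
Qed.

Lemma wedgeZr (c : R[i]) a b : wedge a (c *: b) = c *: wedge a b.
Proof.
apply/ffunP => C; rewrite !ffunE /= scaler_sumr; apply: eq_bigr => A _.
by rewrite ffunE mulrCA.
Qed.

Lemma delE (w : 'E[R]_n -> ext R n) x C : del w x C =
  \sum_(j < n) (lshift n j \in C)%:R
     * shuffle_sign [set lshift n j]%SET (C :\ lshift n j)%SET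
     * wirtinger j w x (C :\ lshift n j)%SET.
Proof. by rewrite sum_ffunE; apply: eq_bigr => j _; rewrite wedge_covec. Qed.

Lemma delbarE (w : 'E[R]_n -> ext R n) x C : delbar w x C =
  \sum_(j < n) (rshift n j \in C)%:R
     * shuffle_sign [set rshift n j]%SET (C :\ rshift n j)%SET
     * wirtinger_bar j w x (C :\ rshift n j)%SET.
Proof. by rewrite sum_ffunE; apply: eq_bigr => j _; rewrite wedge_covec. Qed.

(* The pullback of a form by a diagonal linear map, whose multipliers on the
   coordinates z_j and zbar_j are given by c. *)
Definition rescale (c : I -> R[i]) a : ext R n :=
  [ffun A : {set I} => (\prod_(k in A) c k) * a A].

Lemma rescale_wedge c a b : rescale c (wedge a b) =
  wedge (rescale c a) (rescale c b).
Proof.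
apply/ffunP => C; rewrite !ffunE mulr_sumr; apply: eq_bigr => A AC.
rewrite !ffunE (big_setID A) /= (finset.setIidPr AC); ring.
Qed.

Lemma rescale_wedge_pow c m a :
  rescale c (wedge_pow m a) = wedge_pow m (rescale c a).
Proof.
elim: m => [|m IH]; last by rewrite /= rescale_wedge IH.
apply/ffunP => A; rewrite !ffunE; case: eqP => [->|_]; rewrite ?mulr0 //.
by rewrite finset.big_set0 mul1r.
Qed.

(** In increasing order each covector precedes the whole tail, so no shuffle sign appears. *)
Lemma big_wedge_covec (c : I -> R[i]) (s : seq I) :
  sorted (fun k l : I => (k < l)%N) s ->
  \big[wedge/ext1]_(k <- s) (c k *: covec k) =
  [ffun A : {set I} => (A == [set k in s]%SET)%:R * \prod_(k in A) c k]
  :> ext R n.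
Proof.
elim: s => [_|k s IH ks].
  rewrite big_nil; apply/ffunP => A; rewrite !ffunE.
  have -> : [set k in [::]]%SET = finset.set0 :> {set I} by apply/setP => l;
    rewrite !inE.
  by case: eqP => [->|]; rewrite ?mul0r // finset.big_set0 mulr1.
have lt : forall l, l \in s -> (k < l)%N.
  by apply/allP; apply: (order_path_min _ ks) => x y z; apply: ltn_trans.
rewrite big_cons IH ?(path_sorted ks) //; apply/ffunP => A.
rewrite wedgeZl ffunE /= wedge_covec !ffunE shuffle_sign1.
have kNs : k \notin [set l in s]%SET.
  by rewrite inE; apply/negP => /lt; rewrite ltnn.
case: (boolP (A == _)) => [/eqP->|AE].
  rewrite !inE eqxx.
  have -> : ([set l in k :: s] :\ k = [set l in s])%SET.
    apply/setP => l; rewrite !inE; case: eqP => // ->.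
    by move: kNs; rewrite inE => /negPf ->.
  rewrite eqxx !mul1r eq_card0 ?expr0 ?mul1r.
    rewrite [in RHS](_ : [set l in k :: s]%SET = (k |: [set l in s])%SET);
      last by apply/setP => l; rewrite !inE.
    by rewrite big_setU1.
  by move=> l; rewrite !inE; apply/negP => /andP[/lt kl lk];
    have := ltn_trans kl lk; rewrite ltnn.
rewrite mul0r; case: (boolP (k \in A)) => kA; last by rewrite !mul0r scaler0.
case: eqP => [E|_]; last by rewrite mul0r mulr0 scaler0.
case/negP: AE; apply/eqP/setP => l; move/setP/(_ l): E; rewrite !inE.
by case: eqP => [->|].
Qed.

Lemma enum_sorted A : sorted (fun k l : I => (k < l)%N) (enum A).
Proof.
rewrite /enum_mem; apply: sorted_filter => [x y z|]; first exact: ltn_trans.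
rewrite -enumT; have : sorted ltn (map val (enum I)) by rewrite val_enum_ord
  iota_ltn_sorted.
by rewrite sorted_map.
Qed.

(** This is the sum defining [pullback] in the case where every coordinate 1-form is pulled back to
    a multiple of itself. *)
Lemma big_wedge_rescale (c : I -> R[i]) (w : ext R n) :
  \sum_A w A *: \big[wedge/ext1]_(k <- enum A) (c k *: covec k) = rescale c w.
Proof.
apply/ffunP => B; rewrite sum_ffunE (bigD1 B) //= big1 ?addr0 => [|A AB].
  rewrite !ffunE big_wedge_covec ?ffunE.
    by rewrite set_enum eqxx mul1r mulrC.
  exact: enum_sorted.
rewrite !ffunE big_wedge_covec ?enum_sorted // ffunE set_enum eq_sym.
by rewrite (negPf AB) mul0r scaler0.
Qed.

End Wedge.

(** * The fundamental form in the basis dz, dzbar *)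

Section FundamentalForm.
Context {R : realType} {n : nat}.
Local Notation I := 'I_(n + n).
Local Notation C := R[i].
Implicit Types (A : {set I}) (G B : 'M[R]_(n + n)).

(* Column a lists the coefficients of the real coordinate 1-form dreal a in the
   basis dz_j, dzbar_j. *)
Definition drealmx : 'M[C]_(n + n) :=
  \matrix_(k, a) (dreal a : ext R n) [set k]%SET.

Lemma drealE a : dreal a = \sum_k drealmx k a *: covec k :> ext R n.
Proof.
have lin (c d : C) (j : 'I_n) : (c *: dz j + d *: dzbar j : ext R n) =
    \sum_k (c *: dz j + d *: dzbar j : ext R n) [set k]%SET *: covec k.
  rewrite big_split_ord /=; congr (_ + _);
    rewrite (bigD1 j) //= big1 ?addr0 => [|k kj].
  - rewrite !ffunE !(inj_eq finset.set1_inj) eqxx eq_lrshift.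
    by rewrite /GRing.scale /= mulr1 mulr0 addr0.
  - rewrite !ffunE !(inj_eq finset.set1_inj) (inj_eq (@lshift_inj _ _))
      eq_lrshift (negPf kj) /=.
    by rewrite !scaler0 addr0 scale0r.
  - rewrite !ffunE !(inj_eq finset.set1_inj) eqxx eq_rlshift.
    by rewrite /GRing.scale /= mulr1 mulr0 add0r.
  - rewrite !ffunE !(inj_eq finset.set1_inj) (inj_eq (@rshift_inj _ _))
      eq_rlshift (negPf kj) /=.
    by rewrite !scaler0 addr0 scale0r.
have -> : \sum_k drealmx k a *: covec k = \sum_k (dreal a : ext R n)
  [set k]%SET *: covec k.
  by apply: eq_bigr => k _; rewrite mxE.
rewrite /dreal; case: (fintype.split a) => j.
  by rewrite scalerDr; exact: lin.
by rewrite scalerBr -scaleNr; exact: lin.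
Qed.

Lemma drealmxE : drealmx =
  block_mx (2^-1)%:M ((2 * 'i%C)^-1)%:M (2^-1)%:M (- (2 * 'i%C)^-1)%:M.
Proof.
apply/matrixP => k a; rewrite mxE -[k]splitK -[a]splitK /dreal unsplitK.
case: (fintype.split a) => j; case: (fintype.split k) => l /=;
  rewrite ?(block_mxEul, block_mxEur, block_mxEdl, block_mxEdr);
  rewrite !mxE !ffunE !(inj_eq finset.set1_inj) ?(inj_eq (@rshift_inj _ _))
    ?(inj_eq (@lshift_inj _ _)) ?eq_rlshift ?eq_lrshift /=;
  rewrite /GRing.scale /=; case: (l == j);
  by rewrite /= ?addr0 ?add0r ?subr0 ?sub0r ?mulrN ?mulr1 ?mulr0 ?oppr0 ?mulr0n
    ?mulr1n.
Qed.

Definition real_mx m p (A : 'M[R]_(m, p)) : 'M[C]_(m, p) :=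
  map_mx (real_complex R) A.

(** The coefficients, in the basis dz, dzbar, of the complexified bilinear form with real Gram
    matrix [B]. *)
Definition form_mx B : 'M[C]_(n + n) := drealmx *m real_mx B *m drealmx^T.

Lemma fundamental_formE G : fundamental_form G =
  2^-1 *: \sum_k \sum_l form_mx (Jmx n *m G) k l *: wedge (covec k) (covec l).
Proof.
congr (_ *: _); set B := Jmx n *m G.
under eq_bigr => a _.
  under eq_bigr => b _.
    rewrite [dreal a]drealE [dreal b]drealE wedge_suml scaler_sumr.
    under eq_bigr do rewrite wedgeZl wedge_sumr.
    over.
  over.
rewrite /=.
transitivity (\sum_a \sum_b \sum_k \sum_l
   (drealmx k a * (B a b)%:C%C * drealmx l b) *:
     (wedge (covec k) (covec l) : ext R n)).
  apply: eq_bigr => a _; apply: eq_bigr => b _; apply: eq_bigr => k _.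
  rewrite !scaler_sumr; apply: eq_bigr => l _.
  by rewrite wedgeZr !scalerA; congr (_ *: _); congr (_ * _); rewrite mulrC.
rewrite (pair_bigA _ (fun a b => \sum_k \sum_l _)) /= exchange_big /=.
apply: eq_bigr => k _; rewrite exchange_big /=; apply: eq_bigr => l _.
rewrite -(pair_bigA _ (fun a b => (drealmx k a * (B a b)%:C%C * drealmx l b) *:
  (wedge (covec k) (covec l) : ext R n))) /=.
rewrite mxE scaler_suml exchange_big /=; apply: eq_bigr => b _.
rewrite !mxE mulr_suml scaler_suml; apply: eq_bigr => a _.
by rewrite !mxE.
Qed.

End FundamentalForm.

Section FundamentalFormCoefficients.
Context {R : realType} {n : nat}.
Local Notation I := 'I_(n + n).
Local Notation C := R[i].
Implicit Types (A : {set I}) (G B : 'M[R]_(n + n)).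

Lemma wedge_covec2 (k l k' l' : I) : (k < l)%N ->
  wedge (covec k') (covec l') [set k; l]%SET =
  ((k' == k) && (l' == l))%:R - ((k' == l) && (l' == k))%:R :> C.
Proof.
move=> kl; have klN : k != l by apply: contraTneq kl => ->; rewrite ltnn.
rewrite wedge_covec ffunE shuffle_sign1 !inE.
have [->|k'k] := eqVneq k' k.
  rewrite (negPf klN) /= subr0.
  have -> : ([set k; l] :\ k = [set l])%SET.
    by apply/setP => x; rewrite !inE; case: eqP => //= ->; rewrite (negPf klN).
  rewrite eq_card0 => [|x]; last first.
    rewrite !inE; apply/negP => /andP[/eqP->] lk.
    by have := ltn_trans kl lk; rewrite ltnn.
  by rewrite expr0 !mul1r (inj_eq finset.set1_inj) eq_sym.
have [->|k'l] /= := eqVneq k' l; last by rewrite !mul0r subr0.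
have -> : ([set k; l] :\ l = [set k])%SET.
  by apply/setP => x; rewrite !inE; case: (eqVneq x l) => [->|];
    rewrite ?orbF //= eq_sym (negPf klN).
have -> : #|[set l0 in [set k] | (l0 < l)%N]%SET| = 1%N.
  rewrite -[RHS](cards1 k); apply: eq_card => x; rewrite !inE.
  by case: eqP => //= ->; rewrite kl.
by rewrite expr1 mul1r mulN1r sub0r (inj_eq finset.set1_inj) [k == _]eq_sym.
Qed.

Lemma wedge_covec2_neq0 (k l : I) A : wedge (covec k) (covec l) A != 0 :> C ->
  A = [set k; l]%SET /\ k != l.
Proof.
rewrite wedge_covec ffunE; case: (boolP (k \in A)) => kA;
  last by rewrite !mul0r eqxx.
case: (_ =P [set l]%SET) => [AE _|]; last by rewrite mulr0 eqxx.
rewrite -(finset.setD1K kA) AE; split=> //.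
have : l \in (A :\ k)%SET by rewrite AE inE.
by rewrite !inE eq_sym => /andP[].
Qed.

Lemma fundamental_form2 G (k l : I) : (k < l)%N ->
  fundamental_form G [set k; l]%SET =
  2^-1 * (form_mx (Jmx n *m G) k l - form_mx (Jmx n *m G) l k).
Proof.
move=> kl; rewrite fundamental_formE ffunE /GRing.scale /=; congr (_ * _).
set H := form_mx _.
have E k' l' : (H k' l' *: (wedge (covec k') (covec l') : ext R n)) [set k;
  l]%SET =
    H k' l' * ((k' == k) && (l' == l))%:R - H k' l' *
      ((k' == l) && (l' == k))%:R.
  by rewrite ffunE wedge_covec2 // -mulrBr.
rewrite sum_ffunE; under eq_bigr do (rewrite sum_ffunE;
  under eq_bigr do rewrite E).
under eq_bigr do rewrite sumrB.
have S x y : \sum_k' \sum_l' H k' l' * ((k' == x) && (l' == y))%:R = H x y.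
  rewrite (bigD1 x) //= (bigD1 y) //= !eqxx mulr1 !big1 ?addr0 //.
    by move=> i /negPf iE; rewrite big1 // => j _; rewrite iE mulr0.
  by move=> i /negPf iE; rewrite iE andbF mulr0.
by rewrite sumrB !S.
Qed.

Lemma fundamental_form_neq0 G A : fundamental_form G A != 0 ->
  exists k l : I, (k < l)%N /\ A = [set k; l]%SET.
Proof.
rewrite fundamental_formE ffunE => nz.
have [/existsP[k /existsP[l]]|] :=
  boolP [exists k, exists l, wedge (covec k) (covec l) A != 0 :> C].
  move=> /wedge_covec2_neq0[-> kl].
  have [lt|gt|/val_inj e] := ltngtP k l; first by exists k, l.
    by exists l, k; split => //; rewrite finset.setUC.
  by rewrite e eqxx in kl.
rewrite negb_exists => /forallP z; case/negP: nz.
rewrite sum_ffunE big1 ?scaler0 // => k _; rewrite sum_ffunE big1 // => l _.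
have := z k; rewrite negb_exists => /forallP/(_ l); rewrite negbK => /eqP zE.
by rewrite ffunE zE scaler0.
Qed.

Lemma rescale_fundamental_form (c : I -> C) G G' :
  (forall k l,
     form_mx (Jmx n *m G') k l = c k * form_mx (Jmx n *m G) k l * c l) ->
  fundamental_form G' = rescale c (fundamental_form G).
Proof.
move: (@fundamental_form2 G) (@fundamental_form_neq0 G).
move: (@fundamental_form2 G') (@fundamental_form_neq0 G').
move: (fundamental_form G) (fundamental_form G') => w w'.
move: (form_mx (Jmx n *m G) : I -> I -> C) (form_mx (Jmx n *m G') : I -> I -> C)
  => h h'.
move=> w'E w'nz wE wnz H; apply/ffunP => A; rewrite [RHS]ffunE.
have E (k l : I) : (k < l)%N -> w' [set k; l]%SET = c k * c l * w [set k;
  l]%SET.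
  by move=> kl; rewrite wE // w'E // !H; ring.
have [/wnz[k [l [kl ->]]]|/negPn/eqP z] := boolP (w A != 0).
  rewrite E // big_setU1 ?big_set1 //= !inE; apply: contraTneq kl => ->;
    by rewrite ltnn.
rewrite z mulr0; have [/w'nz[k [l [kl AE]]]|/negPn/eqP//] := boolP (w' A != 0).
by move: z; rewrite AE E // => ->; rewrite mulr0.
Qed.

(** The hypothesis says that [J] becomes diagonal, with entries [c], after the change of basis to
    dz, dzbar. *)
Lemma form_mx_congr (J B : 'M[R]_(n + n)) (c : 'rV[C]_(n + n)) k l :
  drealmx *m real_mx J = diag_mx c *m drealmx ->
  form_mx (J *m B *m J^T) k l = c 0 k * form_mx B k l * c 0 l.
Proof.
move=> JE; have -> : form_mx (J *m B *m J^T) = diag_mx c *m form_mx B *m diag_mx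
  c.
  rewrite /form_mx /real_mx !map_mxM /= !mulmxA JE -!mulmxA; congr (_ *m _).
  congr (_ *m (_ *m _)); rewrite -map_trmx -trmx_mul JE trmx_mul.
  by rewrite tr_diag_mx.
by rewrite mul_diag_mx mul_mx_diag !mxE.
Qed.

(** In the row convention the block matrix is multiplication of z_j by p_j + i q_j; it is diagonal
    on dz and dzbar with conjugate eigenvalues. *)
Lemma drealmx_complex_linear (p q : 'rV[R]_n) :
  drealmx *m real_mx (block_mx (diag_mx p) (diag_mx q) (- diag_mx q)
    (diag_mx p)) =
  diag_mx (row_mx (\row_j Complex (p 0 j) (q 0 j))
    (\row_j Complex (p 0 j) (- q 0 j))) *m drealmx.
Proof.
rewrite drealmxE /real_mx map_block_mx diag_mx_row !mulmx_block.
rewrite !mul_scalar_mx !mul_mx_scalar !scaler0 !addr0 !add0r.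
have E : (2 * 'i%C)^-1 = Complex 0 (- 2^-1) :> C.
  apply: (mulfI (x := 2 * 'i%C)); first by rewrite mulf_neq0 ?pnatr_eq0 //=
    eq_complex /= oner_eq0 andbF.
  rewrite mulfV; last by rewrite mulf_neq0 ?pnatr_eq0 //= eq_complex /= oner_eq0
    andbF.
  have -> : 2 = Complex 2 0 :> C by rewrite -[RHS]/((2 : R)%:C%C) rmorph_nat.
  by apply/eqP; rewrite eq_complex /=; apply/andP; split; apply/eqP; field.
have E2 : 2^-1 = Complex 2^-1 0 :> C by rewrite -[RHS]/((2^-1 : R)%:C%C) fmorphV
  rmorph_nat.
rewrite E E2; congr block_mx; apply/matrixP => i j; rewrite !mxE;
  case: (i == j); rewrite ?mulr1n ?mulr0n /= ?mulr0 ?oppr0 ?addr0 //;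
  apply/eqP; rewrite eq_complex /=; apply/andP; split; apply/eqP; by field.
Qed.

End FundamentalFormCoefficients.

(** * Powers of a (1,1)-form and minors of its matrix *)

Section Minors.
Context {R : realType} {n : nat}.
Local Notation I := 'I_(n + n).
Local Notation C := R[i].
Implicit Types (A B : {set I}).

(** The index set of the monomial formed by the dz at the values of [f] and the dzbar at the values
    of [g]. *)
Definition bidegree_set m (f g : 'I_m -> 'I_n) : {set I} :=
  ([set lshift n (f i) | i : 'I_m] :|: [set rshift n (g i) | i : 'I_m])%SET.

Lemma card_ord_lt m (i : nat) : (i <= m)%N ->
  #|[set k : 'I_m | (k < i)%N]%SET| = i.
Proof.
move=> im; rewrite -sum1_card (eq_bigl (fun k : 'I_m => (k < i)%N));
  last by move=> k; rewrite inE.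
by rewrite -(big_ord_widen m (fun=> 1%N) im) sum1_card card_ord.
Qed.

(** With its counterpart for [rshift], this gives the exponent of the shuffle sign when a pair dz,
    dzbar is split off. The hypothesis on [i] says that [x] has rank [i] among the values of [f]. *)
Lemma card_bidegree_lshift m (f g : 'I_m -> 'I_n) (x : 'I_n) (i : nat) :
  (i <= m)%N ->
    injective f -> (forall k, (f k < x)%N = (k < i)%N) ->
  #|[set y in bidegree_set f g | (y < lshift n x)%N]%SET| = i.
Proof.
move=> im fi fx; rewrite -[RHS](card_ord_lt im).
have inj : injective (fun k => lshift n (f k)) by move=> k k' /lshift_inj/fi.
rewrite -[RHS](card_imset _ inj); apply: eq_card => y; rewrite !inE.
apply/andP/imsetP => [[/orP[] /imsetP[k _ ->] /= lt]|[k + ->]].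
- by exists k => //; rewrite inE -fx.
- by move: lt; rewrite ltnNge (leq_trans (ltnW (ltn_ord x))) // leq_addr.
rewrite inE -fx => lt; split => //=; apply/orP; left; exact: imset_f.
Qed.

Lemma card_bidegree_rshift m (f g : 'I_m -> 'I_n) (x : 'I_n) (i : nat) :
  (i <= m)%N ->
    injective f -> injective g -> (forall k, (g k < x)%N = (k < i)%N) ->
  #|[set y in bidegree_set f g | (y < rshift n x)%N]%SET| = (m + i)%N.
Proof.
move=> im fi gi gx.
have finj : injective (fun k => lshift n (f k)) by move=> k k' /lshift_inj/fi.
have ginj : injective (fun k => rshift n (g k)) by move=> k k' /rshift_inj/gi.
have -> : [set y in bidegree_set f g | (y < rshift n x)%N]%SET =
    ([set lshift n (f k) | k : 'I_m] :|:
      [set rshift n (g k) | k in [set k : 'I_m | (k < i)%N]])%SET.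
  apply/setP => y; rewrite !inE; apply/andP/orP.
    move=> [/orP[yf _|/imsetP[k _ ->] /=]]; first by left.
    by rewrite ltn_add2l gx => lt; right; apply: imset_f; rewrite inE.
  move=> [yf|/imsetP[k + ->]].
    split; first by rewrite yf.
    by move/imsetP: yf => [k _ ->] /=;
      rewrite (leq_trans (ltn_ord _)) // leq_addr.
  rewrite inE -gx => lt; split; last by rewrite /= ltn_add2l.
  by apply/orP; right; apply: imset_f.
rewrite cardsU (card_imset _ finj) card_ord (card_imset _ ginj) card_ord_lt //.
rewrite [X in (_ - X)%N](_ : _ = 0%N) ?subn0 //; apply/eqP;
  rewrite cards_eq0 -finset.subset0.
apply/fintype.subsetP => y;
  rewrite !inE => /andP[/imsetP[k _ ->] /imsetP[l _ /eqP]].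
by rewrite eq_lrshift.
Qed.

Definition strictly_increasing m (f : 'I_m -> 'I_n) :=
  {mono f : i j / (i < j)%N}.

Lemma strictly_increasing_inj m (f : 'I_m -> 'I_n) : strictly_increasing f ->
  injective f.
Proof.
move=> fm i j fij; apply: val_inj => /=; have := fm i j; have := fm j i.
by rewrite fij ltnn => /esym + /esym; case: ltngtP.
Qed.

Lemma lift_increasing m (i : 'I_m) :
  {mono (lift i : 'I_m.-1 -> 'I_m) : j k / (j < k)%N}.
Proof. by move=> j k /=; rewrite !ltnNge leq_bump2. Qed.

Lemma lift_lt m (i : 'I_m.+1) (k : 'I_m) : (lift i k < i)%N = (k < i)%N.
Proof.
rewrite /= /bump; case: (leqP i k) => ik; last by rewrite add0n ik.
by rewrite add1n; apply/negbTE; rewrite -leqNgt (leq_trans ik).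
Qed.

Lemma bidegree_setD m (f g : 'I_m.+1 -> 'I_n) i l : injective f ->
  injective g ->
  (bidegree_set f g :\: [set lshift n (f i); rshift n (g l)])%SET =
  bidegree_set (f \o lift i) (g \o lift l).
Proof.
move=> fi gi; apply/setP => x; rewrite !inE negb_or.
apply/andP/orP => [[/andP[xf xg] /orP[]]|].
- move=> /imsetP[k _ xE]; left; rewrite xE.
  case: (unliftP i k) xE => [k' ->|->] xE;
    first exact: (imset_f (fun k => lshift n (f (lift i k)))).
  by rewrite xE eqxx in xf.
- move=> /imsetP[k _ xE]; right; rewrite xE.
  case: (unliftP l k) xE => [k' ->|->] xE;
    first exact: (imset_f (fun k => rshift n (g (lift l k)))).
  by rewrite xE eqxx in xg.
move=> [] /imsetP[k _ ->] /=.
  rewrite (inj_eq (@lshift_inj _ _)) (inj_eq fi) eq_lrshift eq_sym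
    (negPf (neq_lift i k)).
  by split => //; apply/orP; left; exact: (imset_f (fun k => lshift n (f k))).
rewrite (inj_eq (@rshift_inj _ _)) (inj_eq gi) eq_rlshift eq_sym
  (negPf (neq_lift l k)).
by split => //; apply/orP; right; exact: (imset_f (fun k => rshift n (g k))).
Qed.

Lemma shuffle_sign2 (k l : I) B : k != l ->
  shuffle_sign [set k; l]%SET B =
  (-1) ^+ (#|[set x in B | (x < k)%N]%SET| + #|[set x in B | (x < l)%N]%SET|)
  :> C.
Proof.
move=> kl; congr (_ ^+ _).
pose P (z : I) := [set (z, x) | x in [set x in B | (x < z)%N]]%SET.
have cP z : #|P z| = #|[set x in B | (x < z)%N]%SET| by rewrite card_imset // =>
  x y [].
have -> : [set p : I *
  I | [&& p.1 \in [set k; l]%SET, p.2 \in B & (p.2 < p.1)%N]]%SET =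
    (P k :|: P l)%SET.
  apply/setP => -[x y]; rewrite !inE /=;
    apply/and3P/orP => [[/orP[]/eqP-> yB yx]|[]/imsetP[z + [-> ->]]].
  - by left; apply/imsetP; exists y; rewrite ?inE ?yB.
  - by right; apply/imsetP; exists y; rewrite ?inE ?yB.
  - by rewrite inE => /andP[-> ->]; rewrite eqxx.
  - by rewrite inE => /andP[-> ->]; rewrite eqxx orbT.
rewrite cardsU !cP [X in (_ - X)%N](_ : _ = 0%N) ?subn0 //; apply/eqP;
  rewrite cards_eq0 -finset.subset0.
apply/fintype.subsetP => -[x y];
  rewrite !inE => /andP[/imsetP[z _ [-> _]] /imsetP[z' _ [/eqP]]].
by rewrite (negPf kl).
Qed.

(** Equal to m! times (-1)^(m(m-1)/2): the factorial counts the orders of the m factors, and the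
    sign moves all the dz in front of the dzbar. *)
Definition minor_coef m : C := \prod_(i < m) ((-1) ^+ i * i.+1%:R).

(* By induction on m: each row of the matrix gives a Laplace expansion of the
   same minor, whence the factor m + 1. *)
Lemma wedge_pow_minor (w : ext R n) (h : 'M[C]_n) m (f g : 'I_m -> 'I_n) :
    (forall A, w A != 0 -> exists j k, A = [set lshift n j; rshift n k]%SET) ->
    (forall j k, w [set lshift n j; rshift n k]%SET = h j k) ->
    strictly_increasing f -> strictly_increasing g ->
  wedge_pow m w (bidegree_set f g) = minor_coef m * \det (mxsub f g h).
Proof.
move=> wnz wh; elim: m f g => [|m IH] f g fm gm.
  rewrite /minor_coef big_ord0 mul1r det_mx00 ffunE.
  suff -> : bidegree_set f g = finset.set0 by rewrite eqxx.
  by apply/setP => x; rewrite !inE; apply/negP => /orP[] /imsetP[[]].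
have fi := strictly_increasing_inj fm; have gi := strictly_increasing_inj gm.
pose phi (p : 'I_m.+1 * 'I_m.+1) :=
  [set lshift n (f p.1); rshift n (g p.2)]%SET.
have phi_inj : injective phi.
  move=> [i l] [i' l'] /setP E; congr pair.
    have := E (lshift n (f i)); rewrite !inE eqxx !eq_lrshift !orbF.
    by rewrite (inj_eq (@lshift_inj _ _)) (inj_eq fi) => /esym/eqP.
  have := E (rshift n (g l)); rewrite !inE eqxx !eq_rlshift /=.
  by rewrite (inj_eq (@rshift_inj _ _)) (inj_eq gi) => /esym/eqP.
rewrite /wedge_pow iterS -/(wedge_pow m w) ffunE.
pose F A := shuffle_sign A (bidegree_set f g :\: A)%SET * w A *
  wedge_pow m w (bidegree_set f g :\: A)%SET.
(* Only the pairs [phi p] contribute: on any other subset of the monomial the coefficient of [w] is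
   zero. *)
transitivity (\sum_(A in [set phi p | p : 'I_m.+1 * 'I_m.+1]%SET) F A).
  rewrite big_mkcond [RHS]big_mkcond; apply: eq_bigr => A _.
  case: ifP => AS; case: ifP => // Aphi.
    rewrite /F; have [->|/wnz[j [k AE]]] := eqVneq (w A) 0;
      first by rewrite mulr0 mul0r.
    move: AS; rewrite AE finset.subUset !finset.sub1set !inE =>
      /andP[/orP[]/imsetP[i _ iE] /orP[]/imsetP[l _ lE]].
    - by move/eqP: lE; rewrite eq_rlshift.
    - by move: Aphi; rewrite AE iE lE (imset_f phi (x := (i, l))).
    - by move/eqP: iE; rewrite eq_lrshift.
    - by move/eqP: iE; rewrite eq_lrshift.
  move/imsetP: Aphi => [[i l] _ AE]; move: AS;
    rewrite AE finset.subUset !finset.sub1set !inE.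
  by rewrite (imset_f (fun k => lshift n (f k))) //
    (imset_f (fun k => rshift n (g k))) ?orbT.
rewrite big_imset /=; last by move=> p q _ _; exact: phi_inj.
rewrite -(pair_bigA _ (fun i l => F (phi (i, l)))) /=.
have detE : \det (mxsub f g h) *+ m.+1 = \sum_i \sum_l h (f i) (g l) * cofactor
  (mxsub f g h) i l.
  rewrite -[X in _ *+ X]card_ord -sumr_const; apply: eq_bigr => i _.
  by rewrite (expand_det_row _ i); apply: eq_bigr => l _; rewrite mxE.
(* The shuffle sign has exponent i + (m + l). The cofactor absorbs i + l; what remains is (-1)^m,
   the sign in the last factor of [minor_coef m.+1]. *)
have -> : minor_coef m.+1 * \det (mxsub f g h) =
    (-1) ^+ m * minor_coef m * (\det (mxsub f g h) *+ m.+1).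
  rewrite /minor_coef big_ord_recr /= -mulr_natr; ring.
rewrite detE mulr_sumr; apply: eq_bigr => i _; rewrite mulr_sumr;
  apply: eq_bigr => l _.
rewrite /F wh bidegree_setD // IH; first last.
- by move=> j k /=; rewrite gm lift_increasing.
- by move=> j k /=; rewrite fm lift_increasing.
have fil : injective (f \o lift i) by apply: inj_comp => //; exact: lift_inj.
have gil : injective (g \o lift l) by apply: inj_comp => //; exact: lift_inj.
have il : (i <= m)%N by rewrite -ltnS. have lm : (l <= m)%N by rewrite -ltnS.
rewrite shuffle_sign2 ?eq_lrshift // (@card_bidegree_lshift _ _ _ _ i) //;
  last first.
  by move=> k; rewrite /= fm lift_lt.
rewrite (@card_bidegree_rshift _ _ _ _ l) //; last by move=> k;
  rewrite /= gm lift_lt.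
rewrite /cofactor (_ : row' i (col' l (mxsub f g h)) = mxsub (f \o lift i)
  (g \o lift l) h); last first.
  by apply/matrixP => j k; rewrite !mxE.
rewrite !exprD; ring.
Qed.

End Minors.

(** * Positivity of the powers of the fundamental form *)

Lemma det_posdef (C : numClosedFieldType) m (A : 'M[C]_m) :
    (forall v : 'rV[C]_m, v != 0 ->
       0 < (v *m A *m (map_mx Num.conj v)^T) 0 0) ->
  0 < \det A.
Proof.
move=> pd; have [rs rsE] := closed_field_poly_normal (char_poly A).
rewrite (monicP (char_poly_monic A)) scale1r in rsE.
(* For a left eigenvector [v] the hypothesis reads 0 < r |v|^2; the determinant is the product of
   these eigenvalues. *)
have pos r : r \in rs -> 0 < r.
  move=> rrs; have : root (char_poly A) r by rewrite rsE root_prod_XsubC.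
  rewrite -eigenvalue_root_char => /eigenvalueP[v vA v0]; have := pd v v0.
  rewrite vA -scalemxAl mxE pmulr_lgt0 //.
  rewrite lt0r; apply/andP; split; last first.
    by rewrite mxE sumr_ge0 // => i _; rewrite !mxE -normCK exprn_ge0.
  apply: contra v0 => /eqP z; apply/eqP/rowP => j; apply/eqP;
    rewrite mxE -normr_eq0 -sqrf_eq0.
  move: z; rewrite mxE => /eqP; rewrite psumr_eq0 => [/allP/(_ j)|k _];
    last by rewrite !mxE -normCK exprn_ge0.
  by rewrite mem_index_enum !mxE -normCK => /(_ isT).
have -> : \det A = \prod_(r <- rs) r.
  have size_rs : size rs = m.
    by apply: succn_inj; rewrite -(size_prod_XsubC rs id) -rsE size_char_poly.
  have := char_poly_det A; rewrite -horner_coef0 rsE horner_prod.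
  under eq_bigr do rewrite hornerXsubC sub0r -mulN1r.
  rewrite big_split /= big_const_seq count_predT size_rs -Monoid.iteropE.
  by move/(mulfI _) => -> //; rewrite expf_neq0 // oppr_eq0 oner_eq0.
by rewrite big_seq prodr_gt0.
Qed.

Section Positivity.
Context {R : realType} {n : nat}.
Local Notation I := 'I_(n + n).
Local Notation C := R[i].
Implicit Types (A : {set I}) (G B : 'M[R]_(n + n)).

(** For w = a + ib the cross terms cancel by symmetry of [G], leaving the real values at [a] and
    [b], of which at least one is positive. *)
Lemma posdef_complex G (w : 'rV[C]_(n + n)) : G^T = G ->
    (forall v : 'rV[R]_(n + n), v != 0 -> 0 < (v *m G *m v^T) 0 0) -> w != 0 ->
  0 < (w *m real_mx G *m (map_mx Num.conj w)^T) 0 0.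
Proof.
move=> Gs pd w0.
pose a : 'rV[R]_(n + n) := map_mx (@complex.Re R) w.
pose b : 'rV[R]_(n + n) := map_mx (@complex.Im R) w.
have wE : w = real_mx a + 'i%C *: real_mx b.
  apply/rowP => k; rewrite !mxE; case: (w 0 k) => x y.
  by apply/eqP; rewrite eq_complex /=; apply/andP; split; apply/eqP; ring.
have wcE : map_mx Num.conj w = real_mx a - 'i%C *: real_mx b.
  apply/rowP => k; rewrite !mxE; case: (w 0 k) => x y.
  by apply/eqP; rewrite eq_complex /=; apply/andP; split; apply/eqP; ring.
clearbody a b.
have ii : 'i%C * 'i%C = -1 :> C := sqr_i R.
have sym : b *m G *m a^T = a *m G *m b^T.
  transitivity (b *m G *m a^T)^T; first by apply/matrixP => i j;
    rewrite [RHS]mxE !ord1.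
  by rewrite !trmx_mul Gs trmxK mulmxA.
have -> : (w *m real_mx G *m (map_mx Num.conj w)^T) 0 0 =
    ((a *m G *m a^T) 0 0 + (b *m G *m b^T) 0 0)%:C%C.
  rewrite wcE wE linearB /= linearZ /= mulmxDl !mulmxBr !mulmxDl -!scalemxAl
    -!scalemxAr !scalerA ii.
  rewrite /real_mx !map_trmx -!map_mxM sym.
  rewrite !mxE rmorphD /=; ring.
have pd' (v : 'rV[R]_(n + n)) : 0 <= (v *m G *m v^T) 0 0.
  by have [->|v0] := eqVneq v 0; [rewrite !mul0mx mxE|exact: ltW (pd v v0)].
rewrite ltcR; have [a0|a0] := eqVneq a 0; last by rewrite ltr_pwDl // pd.
rewrite ltr_pwDr //; apply: pd; apply: contra w0 => /eqP b0.
by rewrite wE a0 b0 /real_mx !map_mx0 scaler0 addr0.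
Qed.

End Positivity.

Section Hermitian.
Context {R : realType} {n : nat}.
Local Notation I := 'I_(n + n).
Local Notation C := R[i].
Implicit Types (A : {set I}).

Lemma JmxE : Jmx n = block_mx (diag_mx 0) (diag_mx (const_mx 1))
  (- diag_mx (const_mx 1)) (diag_mx 0) :> 'M[R]_(n + n).
Proof. by rewrite /Jmx !diag_const_mx (raddf0 (@scalar_mx _ _)). Qed.

Lemma trmx_Jmx : (Jmx n)^T = - Jmx n :> 'M[R]_(n + n).
Proof.
by rewrite /Jmx tr_block_mx !trmx0 linearN /= !trmx1 opp_block_mx !oppr0
  opprK.
Qed.

Lemma Jmx_sqr : Jmx n *m Jmx n = - 1%:M :> 'M[R]_(n + n).
Proof.
rewrite mulmx_block !mul0mx !mulmx0 !add0r !addr0 !mulNmx !mulmxN !mulmx1.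
by rewrite [in RHS]scalar_mx_block opp_block_mx !oppr0.
Qed.

Variable G : 'M[R]_(n + n).
Hypothesis G_sym : G^T = G.
Hypothesis G_pos : forall v : 'rV[R]_(n + n), v != 0 -> 0 < (v *m G *m v^T) 0 0.
Hypothesis G_J : Jmx n *m G *m (Jmx n)^T = G.

Let H := form_mx (Jmx n *m G).
Let i_row : 'rV[C]_(n + n) :=
  row_mx (\row_j Complex 0 1) (\row_j Complex 0 (- 1)).

Lemma drealmx_Jmx : drealmx *m real_mx (Jmx n) = diag_mx i_row *m drealmx.
Proof.
rewrite JmxE drealmx_complex_linear; congr (diag_mx (row_mx _ _) *m _);
  by apply/rowP => j; rewrite !mxE.
Qed.

Lemma form_mx_J k l : H k l = i_row 0 k * H k l * i_row 0 l.
Proof.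
by rewrite -(form_mx_congr _ _ _ drealmx_Jmx) -!mulmxA
  [in X in _ = form_mx (_ *m X) _ _]mulmxA G_J.
Qed.

Lemma form_mx_anti k l : H l k = - H k l.
Proof.
suff E : (Jmx n *m G)^T = - (Jmx n *m G).
  have -> : H l k = (H^T) k l by rewrite [RHS]mxE.
  rewrite /H /form_mx !trmx_mul trmxK /real_mx map_trmx E.
  by rewrite map_mxN mulNmx mulmxN mulmxA mxE.
rewrite trmx_mul G_sym trmx_Jmx mulmxN -[X in X *m Jmx n]G_J trmx_Jmx.
by rewrite mulmxN mulNmx -mulmxA Jmx_sqr mulmxN mulmx1 opprK.
Qed.

Let i_sqr : 'i%C * 'i%C = -1 :> C := sqr_i R.

(** Between two indices of the same type, [form_mx_J] multiplies the entry by the square of i or of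
    -i, that is by -1, so the entry vanishes. *)
Lemma fundamental_form_type11 A : fundamental_form G A != 0 ->
  exists j k, A = [set lshift n j; rshift n k]%SET.
Proof.
have Ni_sqr : Complex 0 (-1) * Complex 0 (-1) = -1 :> C.
  have -> : Complex 0 (-1) = - 'i%C :> C by apply/eqP;
    rewrite eq_complex /= oppr0 !eqxx.
  by rewrite mulrNN i_sqr.
have z (x : C) : x = - x -> x = 0.
  by move=> /eqP; rewrite -addr_eq0 -mulr2n mulrn_eq0 => /eqP.
have Hll j k : H (lshift n j) (lshift n k) = 0.
  by apply: z; rewrite [LHS]form_mx_J !row_mxEl !mxE mulrAC i_sqr mulN1r.
have Hrr j k : H (rshift n j) (rshift n k) = 0.
  by apply: z; rewrite [LHS]form_mx_J !row_mxEr !mxE mulrAC Ni_sqr mulN1r.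
move=> nz; have [k [l [kl AE]]] := fundamental_form_neq0 nz.
move: nz kl; rewrite AE => /[swap] kl;
  rewrite fundamental_form2 // -/H (form_mx_anti k l) opprK.
move: kl; rewrite -[k]splitK -[l]splitK.
case: (fintype.split k) (fintype.split l) => j [j'|j'] /= kl nz.
- by rewrite Hll addr0 mulr0 eqxx in nz.
- by exists j, j'.
- by move: kl; rewrite ltnNge (leq_trans (ltnW (ltn_ord _))) // leq_addr.
- by rewrite Hrr addr0 mulr0 eqxx in nz.
Qed.

Let Q := drealmx *m real_mx G *m drealmx^T.

(** J acts by i on the rows of type dz, and the factor 1/2 is cancelled by the two equal
    contributions of an antisymmetric matrix. *)
Lemma fundamental_form_lr j k :
  fundamental_form G [set lshift n j; rshift n k]%SET =
  'i%C * Q (lshift n j) (rshift n k).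
Proof.
rewrite fundamental_form2;
  last by rewrite /= (leq_trans (ltn_ord _)) // leq_addr.
rewrite -/H (form_mx_anti (lshift n j)) opprK -mulr2n -[X in _ * X]mulr_natl
  mulKf ?pnatr_eq0 //.
have -> : H = diag_mx i_row *m Q.
  have E : real_mx (Jmx n *m G) = real_mx (Jmx n) *m real_mx G
    by exact: map_mxM.
  by rewrite /H /form_mx E [drealmx *m _]mulmxA drealmx_Jmx /Q !mulmxA.
by rewrite mul_diag_mx mxE row_mxEl mxE.
Qed.

(** The rows of [drealmx] of type dzbar are the conjugates of those of type dz, so this block of [Q]
    is F G F^* and inherits positivity from the complexified metric. *)
Lemma det_hermitian_minor m (f : 'I_m -> 'I_n) : injective f ->
  0 < \det (\matrix_(x, y) Q (lshift n (f x)) (rshift n (f y))).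
Proof.
move=> fi; apply: det_posdef => v v0.
pose F : 'M[C]_(m, n + n) := \matrix_(x, a) drealmx (lshift n (f x)) a.
have FcE : map_mx Num.conj F = \matrix_(x, a) drealmx (rshift n (f x)) a.
  apply/matrixP => x a;
    rewrite [LHS]mxE [F x a]mxE [RHS]mxE -[a]splitK drealmxE;
      case: (fintype.split a) => j /=.
    by rewrite block_mxEul block_mxEdl !mxE rmorphMn /= fmorphV rmorph_nat.
  rewrite block_mxEur block_mxEdr !mxE rmorphMn /= fmorphV rmorphM rmorph_nat
    /=.
  rewrite -invrN -mulrN; congr ((_ * _)^-1 *+ _).
  by apply/eqP; rewrite eq_complex /= oppr0 !eqxx.
have -> : (\matrix_(x, y) Q (lshift n (f x)) (rshift n (f y))) = F *m real_mx
  G *m (map_mx Num.conj F)^T.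
  rewrite FcE; apply/matrixP => x y; rewrite !mxE; apply: eq_bigr => b _;
    rewrite !mxE.
  by congr (_ * _); apply: eq_bigr => a _; rewrite !mxE.
have -> : v *m (F *m real_mx G *m (map_mx Num.conj F)^T) *m
  (map_mx Num.conj v)^T =
  (v *m F) *m real_mx G *m (map_mx Num.conj (v *m F))^T.
  by rewrite map_mxM trmx_mul !mulmxA.
(* [v *m F] is nonzero because its coordinate at [lshift n (f x)] is half the coordinate of [v] at
   [x]. *)
apply: posdef_complex => //; apply: contra v0 => /eqP/rowP vF0.
apply/eqP/rowP => x; rewrite mxE.
have := vF0 (lshift n (f x)); rewrite mxE [RHS]mxE (bigD1 x) //= big1 ?addr0.
  rewrite [F x _]mxE drealmxE block_mxEul mxE eqxx mulr1n => /eqP.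
  by rewrite mulf_eq0 invr_eq0 pnatr_eq0 orbF => /eqP.
move=> y yx; rewrite [F y _]mxE drealmxE block_mxEul mxE (inj_eq fi) (negPf yx).
by rewrite mulr0n mulr0.
Qed.

Lemma wedge_pow_fundamental_form m (f : 'I_m -> 'I_n) : strictly_increasing f ->
  0 < (minor_coef m * 'i%C ^+ m)^-1 * wedge_pow m (fundamental_form G)
    (bidegree_set f f).
Proof.
move=> fm; have fi := strictly_increasing_inj fm.
rewrite (@wedge_pow_minor _ _ _
  (\matrix_(j, k) ('i%C * Q (lshift n j) (rshift n k)))) //; last 2 first.
- exact: fundamental_form_type11.
- by move=> j k; rewrite fundamental_form_lr [RHS]mxE.
have -> : mxsub f f (\matrix_(j, k) ('i%C * Q (lshift n j) (rshift n k))) =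
   'i%C *: (\matrix_(x, y) Q (lshift n (f x)) (rshift n (f y))).
  by apply/matrixP => x y; rewrite !mxE.
rewrite detZ [X in _ * X]mulrA mulKf; first exact: det_hermitian_minor.
rewrite mulf_neq0 ?expf_neq0 //; last by rewrite eq_complex /= oner_eq0 andbF.
by apply/prodf_neq0 => i _; rewrite mulf_neq0 ?signr_eq0 ?pnatr_eq0.
Qed.

End Hermitian.

(** * Lifting to the cover *)

Section Germs.
Context {R : realType}.

(** The divergence argument consumes only one derivative, and in class C^1 stability under sums and
    products requires no induction on iterated partial derivatives. *)
Definition C1_on m (A : set 'rV[R]_m) (f : 'rV[R]_m -> R) := forall x, A x ->
  {for x, continuous f} /\
  forall a, derivable f x (delta_mx 0 a) /\ {for x, continuous (partial a f)}.

Lemma smooth_on_C1 m (A : set 'rV[R]_m) f : smooth_on A f -> C1_on A f.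
Proof.
move=> fs x Ax; split; first by have [] := fs [::] x Ax.
by move=> a; split; [have [_] := fs [::] x Ax; exact|have [] := fs [:: a] x Ax].
Qed.

Lemma near_eq_continuous_at m (f h : 'rV[R]_m -> R) (x : 'rV[R]_m) :
  (\near x, f x = h x) -> {for x, continuous h} -> {for x, continuous f}.
Proof.
move=> fh hc; suff : f @ x --> f x by [].
rewrite (nbhs_singleton fh); apply: cvg_trans (hc : h @ x --> _).
have fh' : {near x, h =1 f} by apply: filterS fh => y ->.
exact: (near_eq_cvg fh').
Qed.

Lemma near_partial m a (f h : 'rV[R]_m -> R) (x : 'rV[R]_m) :
  (\near x, f x = h x) -> \near x, partial a f x = partial a h x.
Proof. by move=> /near_join; apply: filterS => y; exact: near_eq_derive. Qed.

Lemma C1_on_germ m (A : set 'rV[R]_m) f :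
  (forall x, A x -> exists V h, [/\ V x, C1_on V h & \near x, f x = h x]) ->
    C1_on A f.
Proof.
move=> fA x /fA[V [h [Vx hs fh]]]; have [hc hd] := hs x Vx.
split; first exact: near_eq_continuous_at fh hc.
move=> a; have [da ca] := hd a; split.
  by apply: near_eq_derivable da; apply: filterS fh => y ->.
exact: near_eq_continuous_at (near_partial a fh) ca.
Qed.

Context {n : nat}.

Lemma near_cpartial a (f h : 'E[R]_n -> R[i]) (x : 'E[R]_n) :
  (\near x, f x = h x) -> cpartial a f x = cpartial a h x.
Proof.
by move=> fh; congr Complex; apply: near_eq_derive; apply: filterS fh => y ->.
Qed.

Lemma near_ext_partial a (w w' : 'E[R]_n -> ext R n) (x : 'E[R]_n) :
  (\near x, w x = w' x) -> ext_partial a w x = ext_partial a w' x.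
Proof.
move=> ww; apply/ffunP => A; rewrite !ffunE.
by apply: near_cpartial; apply: filterS ww => y ->.
Qed.

Lemma near_del (w w' : 'E[R]_n -> ext R n) (x : 'E[R]_n) :
  (\near x, w x = w' x) -> del w x = del w' x.
Proof.
move=> ww; rewrite /del; apply: eq_bigr => j _.
have -> // : wirtinger j w x = wirtinger j w' x.
by rewrite /wirtinger !(near_ext_partial _ ww).
Qed.

Lemma near_delbar (w w' : 'E[R]_n -> ext R n) (x : 'E[R]_n) :
  (\near x, w x = w' x) -> delbar w x = delbar w' x.
Proof.
move=> ww; rewrite /delbar; apply: eq_bigr => j _.
have -> // : wirtinger_bar j w x = wirtinger_bar j w' x.
by rewrite /wirtinger_bar !(near_ext_partial _ ww).
Qed.

Lemma near_pullback (f h : 'E[R]_n -> 'E[R]_n) (w : 'E[R]_n -> ext R n)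
  (x : 'E[R]_n) :
  (\near x, f x = h x) -> pullback f w x = pullback h w x.
Proof.
move=> fh; rewrite /pullback (nbhs_singleton fh); apply: eq_bigr => A _;
  congr (_ *: _).
apply: eq_bigr => k _; apply: eq_bigr => a _; congr (_ *: _).
by apply: near_cpartial; apply: filterS fh => y ->.
Qed.

End Germs.

Section GlobalForms.
Context {R : realType} {K : fieldExtType rat} {s t : nat}.
Context (sigma : 'I_(s + t + t) -> {rmorphism K -> R[i]}).
Local Notation n := (s + t)%N.
Local Notation E := ('rV[R]_(n + n)).
Local Notation act := (ot_act sigma).

Definition multiplier (u : K) (k : 'I_(n + n)) : R[i] :=
  match fintype.split k with
  | inl j => sigma (lshift t j) u
  | inr j => conjc (sigma (lshift t j) u)
  end.

(** The translation disappears on differentiation, and multiplication by the embeddings is diagonal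
    in dz, dzbar. *)
Lemma pullback_covec_act g x k :
  pullback_covec (act g) x k = multiplier g.2 k *: covec k.
Proof.
have jacE a b : partial a (fun y => act g y 0 b) x = jac (act g) x a b
  by rewrite mxE.
have jacN a b : partial a (fun y => - act g y 0 b) x = - jac (act g) x a b.
  rewrite -jacE /partial (deriveN (f := fun y => act g y 0 b)) //.
  by have [_ /(_ a)] := @ot_act_smooth _ _ _ _ sigma g b [::] x I.
have ic : 'i%C * (2 * 'i%C)^-1 = 2^-1 :> R[i].
  rewrite invfM mulrCA mulfV ?mulr1 //.
  by rewrite eq_complex /= oner_eq0 andbF.
have half (v : ext R n) : 2^-1 *: (v + v) = v.
  have h2 : (2 : R[i]) != 0 by rewrite pnatr_eq0.
  by apply: (scalerI h2); rewrite scalerA mulfV // scale1r scaler_nat mulr2n.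
have jll i j : jac (act g) x (lshift n i) (lshift n j) = complex.Re
  (sigma (lshift t j) g.2) *+ (i == j).
  by rewrite ot_act_jac block_mxEul !mxE; case: eqP => [->|].
have jlr i j : jac (act g) x (lshift n i) (rshift n j) = complex.Im
  (sigma (lshift t j) g.2) *+ (i == j).
  by rewrite ot_act_jac block_mxEur !mxE; case: eqP => [->|].
have jrl i j : jac (act g) x (rshift n i) (lshift n j) = - complex.Im
  (sigma (lshift t j) g.2) *+ (i == j).
  by rewrite ot_act_jac block_mxEdl !mxE; case: eqP => [->|];
    rewrite // mulr0n oppr0.
have jrr i j : jac (act g) x (rshift n i) (rshift n j) = complex.Re
  (sigma (lshift t j) g.2) *+ (i == j).
  by rewrite ot_act_jac block_mxEdr !mxE; case: eqP => [->|].
have cpE a j : cpartial a (fun y => ccoord (lshift n j) (act g y)) x =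
    Complex (jac (act g) x a (lshift n j)) (jac (act g) x a (rshift n j)).
  by rewrite -!jacE /cpartial /ccoord (unsplitK (inl j)).
have cpcE a j : cpartial a (fun y => ccoord (rshift n j) (act g y)) x =
    Complex (jac (act g) x a (lshift n j)) (- jac (act g) x a (rshift n j)).
  by rewrite -jacN -!jacE /cpartial /ccoord (unsplitK (inr j)).
have dl j : dreal (lshift n j) = 2^-1 *: (dz j + dzbar j) :> ext R n.
  by rewrite /dreal (unsplitK (inl j)).
have dr j : dreal (rshift n j) = (2 * 'i%C)^-1 *: (dz j - dzbar j) :> ext R n.
  by rewrite /dreal (unsplitK (inr j)).
have sumE (f : 'I_(n + n) -> R[i]) j : (forall i, i != j -> f (lshift n i) = 0)
  ->
    (forall i, i != j -> f (rshift n i) = 0) ->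
    \sum_a f a *: (dreal a : ext R n) = f (lshift n j) *: dreal (lshift n j) +
      f (rshift n j) *: dreal (rshift n j).
  move=> fl fr; rewrite big_split_ord /=; congr (_ + _).
    by rewrite (bigD1 j) //= big1 ?addr0 // => i /fl ->; rewrite scale0r.
  by rewrite (bigD1 j) //= big1 ?addr0 // => i /fr ->; rewrite scale0r.
rewrite /pullback_covec -[k]splitK; case: (fintype.split k) => j /=.
  rewrite (sumE _ j) => [|i /negPf ij|i /negPf ij]; last 2 first.
  - by rewrite cpE jll jlr ij.
  - by rewrite cpE jrl jrr ij.
  rewrite !cpE jll jlr jrl jrr eqxx !mulr1n dl dr /multiplier
    (unsplitK (inl j)).
  case: (sigma _ g.2) => p q /=.
  have -> : Complex (- q) p = Complex p q * 'i%C.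
    by apply/eqP; rewrite eq_complex /=; apply/andP; split; apply/eqP; ring.
  rewrite -(scalerA _ 'i%C) (scalerA 'i%C) ic -!scalerDr addrACA subrr addr0.
  by rewrite half.
rewrite (sumE _ j) => [|i /negPf ij|i /negPf ij]; last 2 first.
- by rewrite cpcE jll jlr ij /= oppr0.
- by rewrite cpcE jrl jrr ij /= oppr0.
rewrite !cpcE jll jlr jrl jrr eqxx !mulr1n dl dr /multiplier (unsplitK (inr j)).
case: (sigma _ g.2) => p q /=.
have -> : Complex (- q) (- p) = Complex p (- q) * (- 'i%C).
  by apply/eqP; rewrite eq_complex /=; apply/andP; split; apply/eqP; ring.
rewrite -(scalerA _ (- 'i%C)) (scalerA (- 'i%C)) mulNr ic scaleNr -scalerN opprB
  -!scalerDr.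
by rewrite [dz j + _]addrC addrACA subrr addr0 half.
Qed.

Lemma pullback_act g w x :
  pullback (act g) w x = rescale (multiplier g.2) (w (act g x)).
Proof.
rewrite -big_wedge_rescale /pullback; apply: eq_bigr => A _; congr (_ *: _).
by apply: eq_bigr => k _; rewrite pullback_covec_act.
Qed.

End GlobalForms.

Section Lift.
Context {R : realType} {K : fieldExtType rat} {s t : nat}.
Context (sigma : 'I_(s + t + t) -> {rmorphism K -> R[i]}).
Context (s_gt0 : (0 < s)%N) (emb : embeddings_of_type sigma).
Context (U : set K) (adm : admissible sigma U).
Local Notation n := (s + t)%N.
Local Notation E := ('rV[R]_(n + n)).
Local Notation act := (ot_act sigma).
Local Notation M := (@ot_cover R s t).
Local Notation G := (ot_group U).

(** Equivariant data on H^s x C^t; once they are obtained, the atlas of the quotient is no longer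
    consulted. The last two fields are invariance under pullback, in explicit form. *)
Record sg_lift (g : E -> 'M[R]_(n + n)) (al : E -> ext R n) : Prop := {
  lift_metric_C1 : forall a b, C1_on M (fun z => g z a b);
  lift_form_C1 : forall A, C1_on M (fun z => complex.Re (al z A)) /\
                           C1_on M (fun z => complex.Im (al z A));
  lift_sym : forall z, M z -> (g z)^T = g z;
  lift_pos : forall z, M z -> forall v : E, v != 0 -> 0 < (v *m g z *m v^T) 0 0;
  lift_J : forall z, M z -> Jmx n *m g z *m (Jmx n)^T = g z;
  lift_eq : forall z, M z ->
    del (fun x => wedge_pow n.-1 (fundamental_form (g x))) z = delbar al z;
  lift_metric_act : forall h z, G h -> M z ->
    g z = jac (act h) z *m g (act h z) *m (jac (act h) z)^T;
  lift_form_act : forall h z, G h -> M z ->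
    al z = rescale (multiplier sigma h.2) (al (act h z)) }.

Lemma near_transition V V' (h : K * K) z : open V' ->
    {in V &, injective (ot_orbit sigma U)} ->
    {in V' &, injective (ot_orbit sigma U)} ->
    G h -> V' (act h z) ->
  \forall y \near z, transition (ot_chart sigma U V) (ot_chart sigma U V') y =
    act h y.
Proof.
move=> oV' Vi Vi' Gh Vhz.
have hV' : nbhs (act h z) V' by apply: open_nbhs_nbhs.
have zV' : nbhs z (act h @^-1` V')
  by exact: (@ot_act_continuous _ _ _ _ _ h z _ hV').
apply: (@filterS _ (nbhs z) _ _ _ _ zV') => y V'y.
by rewrite /transition /= -(ot_orbit_act adm y Gh) -[RHS](ot_cmapK adm Vi' V'y).
Qed.

(** The lift at [z] is read in a chosen slice through [z]. The slices need not depend continuously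
    on [z], but any two give the same values, so near each point the lift is the local expression in
    one fixed chart, from which regularity and the differential equation follow. *)
Lemma strongly_gauduchon_lift g :
  strongly_gauduchon (X := OT_manifold s_gt0 emb adm) g ->
  exists gh alh, sg_lift gh alh.
Proof.
move=> [[gs gt gsym gpos gJ] [al [als alt] eq]].
have /choice[V_ V_P] : forall z : E, exists V : set E, M z ->
    [/\ open V, V z, V `<=` M & {in V &, injective (ot_orbit sigma U)}].
  move=> z; have [Mz|NMz] := pselect (M z); last by exists set0.
  have [V [oV Vz _ VM Vi]] := ot_slice s_gt0 emb adm Mz ot_cover_open Mz.
  by exists V.
pose c z := ot_chart sigma U (V_ z).
have ac z : M z -> atlas (OT_manifold s_gt0 emb adm) (c z).
  by move=> /V_P[oV Vz VM Vi]; exists (V_ z).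
have codc z : M z -> ccod (c z) = V_ z by move=> /V_P[_ _ _ Vi];
  exact: (ot_ccod adm Vi).
have ovl z y h : M z -> M y -> V_ z y -> G h -> V_ (act h y) (act h y) ->
  M (act h y) ->
    overlap (c z) (c (act h y)) y.
  move=> Mz My Vy Gh Vhy Mhy; have [_ _ _ Vi] := V_P z Mz.
  by rewrite (ot_overlap adm _ Vi); split => //; exists h.
have alT z y h : M z -> M y -> V_ z y -> G h ->
    al (c z) y = rescale (multiplier sigma h.2) (al (c (act h y)) (act h y)).
  move=> Mz My Vy Gh; have Mhy := ot_act_cover emb adm Gh My.
  have [oV Vhy VM Vi'] := V_P _ Mhy; have [_ _ _ Vi] := V_P z Mz.
  rewrite (alt _ _ (ac _ Mz) (ac _ Mhy)); last exact: ovl.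
  by rewrite (near_pullback _ (near_transition oV Vi Vi' Gh Vhy)) pullback_act.
have gT z y h : M z -> M y -> V_ z y -> G h ->
    g (c z) y = jac (act h) y *m g (c (act h y)) (act h y) *m (jac (act h) y)^T.
  move=> Mz My Vy Gh; have Mhy := ot_act_cover emb adm Gh My.
  have [oV Vhy VM Vi'] := V_P _ Mhy; have [_ _ _ Vi] := V_P z Mz.
  have nt := near_transition oV Vi Vi' Gh Vhy.
  rewrite (gt _ _ (ac _ Mz) (ac _ Mhy)); last exact: ovl.
  by rewrite (jac_germ nt) (nbhs_singleton nt).
(* With the neutral element, the transformation rules [alT] and [gT] compare two slices at one
   point; with a general element they give equivariance. *)
have G1 := ot_group1 adm.
have alE z y : M z -> M y -> V_ z y -> al (c z) y = al (c y) y.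
  move=> Mz My Vy; rewrite (alT z y (0, 1)) // ot_act1; apply/ffunP => A.
  rewrite ffunE big1 ?mul1r // => k _; rewrite /multiplier.
  by case: (fintype.split k) => j; rewrite rmorph1 // rmorph1.
have gE z y : M z -> M y -> V_ z y -> g (c z) y = g (c y) y.
  move=> Mz My Vy; rewrite (gT z y (0, 1)) // ot_act1.
  suff -> : jac (act (0, 1)) y = 1%:M by rewrite mul1mx trmx1 mulmx1.
  rewrite ot_act_jac /= (_ : \row_j _ = const_mx 1); last by apply/rowP => j;
    rewrite !mxE rmorph1.
  rewrite (_ : \row_j _ = 0); last by apply/rowP => j; rewrite !mxE rmorph1.
  by rewrite diag_const_mx (raddf0 (@diag_mx _ _)) oppr0 -scalar_mx_block.
have near_V z : M z -> \forall y \near z, V_ z y /\ M y.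
  move=> Mz; have [oV Vz VM _] := V_P z Mz.
  by apply: open_nbhs_nbhs; split; [exact: openI oV ot_cover_open|split].
have near_al z : M z -> \forall y \near z, al (c y) y = al (c z) y.
  by move=> Mz; apply: filterS (near_V z Mz) => y [Vy My]; rewrite -(alE z).
have near_g z : M z -> \forall y \near z, g (c y) y = g (c z) y.
  by move=> Mz; apply: filterS (near_V z Mz) => y [Vy My]; rewrite -(gE z).
exists (fun z => g (c z) z), (fun z => al (c z) z); split.
- move=> a b; apply: C1_on_germ => z Mz; have [_ Vz _ _] := V_P z Mz.
  exists (V_ z), (fun y => g (c z) y a b); split => //.
    by rewrite -(codc z Mz); apply/smooth_on_C1/gs/ac.
  by apply: filterS (near_g z Mz) => y ->.
- move=> A; split; apply: C1_on_germ => z Mz; have [_ Vz _ _] := V_P z Mz.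
    exists (V_ z), (fun y => complex.Re (al (c z) y A)); split => //.
      by rewrite -(codc z Mz); apply: smooth_on_C1;
        have [] := als _ (ac _ Mz) A.
    by apply: filterS (near_al z Mz) => y ->.
  exists (V_ z), (fun y => complex.Im (al (c z) y A)); split => //.
    by rewrite -(codc z Mz); apply: smooth_on_C1; have [] := als _ (ac _ Mz) A.
  by apply: filterS (near_al z Mz) => y ->.
- by move=> z Mz; have [_ Vz _ _] := V_P z Mz;
    rewrite (gsym _ (ac _ Mz)) // codc.
- by move=> z Mz v v0; have [_ Vz _ _] := V_P z Mz;
    rewrite (gpos _ (ac _ Mz)) // codc.
- by move=> z Mz; have [_ Vz _ _] := V_P z Mz; rewrite (gJ _ (ac _ Mz)) // codc.
- move=> z Mz; have [_ Vz _ _] := V_P z Mz.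
  rewrite (near_delbar (near_al z Mz)) -(eq _ (ac _ Mz)); last by rewrite codc.
  by apply: near_del; apply: filterS (near_g z Mz) => y ->.
- by move=> h z Gh Mz; have [_ Vz _ _] := V_P z Mz; apply: gT.
- by move=> h z Gh Mz; have [_ Vz _ _] := V_P z Mz; apply: alT.
Qed.

(** The differential of the action commutes with J, so the rule for the metric becomes one for the
    matrix of the fundamental form, on which the differential is diagonal. *)
Lemma lift_power_act gh alh h z : sg_lift gh alh -> G h -> M z -> forall m,
  wedge_pow m (fundamental_form (gh z)) =
  rescale (multiplier sigma h.2)
    (wedge_pow m (fundamental_form (gh (act h z)))).
Proof.
move=> L Gh Mz m; rewrite rescale_wedge_pow; congr (wedge_pow m _).
apply: rescale_fundamental_form => k l.
pose p : 'rV[R]_n := \row_j complex.Re (sigma (lshift t j) h.2).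
pose q : 'rV[R]_n := \row_j complex.Im (sigma (lshift t j) h.2).
pose c : 'rV[R[i]]_(n + n) := row_mx (\row_j Complex (p 0 j) (q 0 j))
  (\row_j Complex (p 0 j) (- q 0 j)).
have cE : drealmx *m real_mx (jac (act h) z) = diag_mx c *m drealmx.
  by rewrite ot_act_jac drealmx_complex_linear.
have -> : Jmx n *m gh z = jac (act h) z *m (Jmx n *m gh (act h z)) *m
  (jac (act h) z)^T.
  by rewrite (lift_metric_act L Gh Mz) !mulmxA (ot_act_holo sigma h z).
have mE a : c 0 a = multiplier sigma h.2 a.
  rewrite /c /multiplier -[a]splitK unsplitK; case: (fintype.split a) => j /=.
    by rewrite row_mxEl !mxE; case: (sigma _ _).
  by rewrite row_mxEr !mxE; case: (sigma _ _).
by rewrite (form_mx_congr _ _ _ cE) !mE.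
Qed.

End Lift.

(** * A divergence-free field on the cover *)

Section C1.
Context {R : realType} {m : nat} (A : set 'rV[R]_m).
Hypothesis oA : open A.
Implicit Types (f h : 'rV[R]_m -> R).

Lemma C1_on_cst (c : R) : C1_on A (fun=> c).
Proof.
have pE a : partial a (fun=> c : R) = (fun=> 0) :> ('rV[R]_m -> R).
  by apply/funext => x; rewrite /partial derive_cst.
move=> x _; split; first exact: cst_continuous.
by move=> a; rewrite pE; split; [exact: derivable_cst|exact: cst_continuous].
Qed.

Lemma near_open (P : 'rV[R]_m -> Prop) x : A x -> (forall y, A y -> P y) ->
  \forall y \near x, P y.
Proof.
move=> Ax AP; have : nbhs x A by apply: open_nbhs_nbhs.
exact: filterS.
Qed.

Lemma C1_onD f h : C1_on A f -> C1_on A h -> C1_on A (fun x => f x + h x).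
Proof.
move=> fA hA x Ax; have [fc fd] := fA x Ax; have [hc hd] := hA x Ax.
split; first exact: (continuousD fc hc).
move=> a; have [df cf] := fd a; have [dh ch] := hd a; split.
  exact: (derivableD df dh).
apply: (near_eq_continuous_at _ (continuousD cf ch)).
apply: near_open Ax _ => y Ay; have [_ /(_ a)[df' _]] := fA y Ay;
  have [_ /(_ a)[dh' _]] := hA y Ay.
exact: (deriveD df' dh').
Qed.

Lemma C1_onM f h : C1_on A f -> C1_on A h -> C1_on A (fun x => f x * h x).
Proof.
move=> fA hA x Ax; have [fc fd] := fA x Ax; have [hc hd] := hA x Ax.
split; first exact: (continuousM fc hc).
move=> a; have [df cf] := fd a; have [dh ch] := hd a; split.
  exact: (derivableM df dh).
apply: (near_eq_continuous_at _
  (continuousD (continuousM fc ch) (continuousM hc cf))).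
apply: near_open Ax _ => y Ay; have [_ /(_ a)[df' _]] := fA y Ay;
  have [_ /(_ a)[dh' _]] := hA y Ay.
exact: (deriveM df' dh').
Qed.

Definition complex_C1_on (f : 'rV[R]_m -> R[i]) :=
  C1_on A (fun x => complex.Re (f x)) /\ C1_on A (fun x => complex.Im (f x)).

Lemma complex_C1_on_cst (c : R[i]) : complex_C1_on (fun=> c).
Proof. by split; exact: C1_on_cst. Qed.

Lemma complex_C1_onD (f h : 'rV[R]_m -> R[i]) : complex_C1_on f ->
  complex_C1_on h -> complex_C1_on (fun x => f x + h x).
Proof.
move=> [fr fi] [hr hi]; split.
  have -> : (fun x => complex.Re (f x + h x)) =
    (fun x => complex.Re (f x) + complex.Re (h x)).
    by apply/funext => x; rewrite raddfD.
  exact: C1_onD.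
have -> : (fun x => complex.Im (f x + h x)) =
  (fun x => complex.Im (f x) + complex.Im (h x)).
  by apply/funext => x; rewrite raddfD.
exact: C1_onD.
Qed.

Lemma complex_C1_onM (f h : 'rV[R]_m -> R[i]) : complex_C1_on f ->
  complex_C1_on h -> complex_C1_on (fun x => f x * h x).
Proof.
move=> [fr fi] [hr hi]; split.
  have -> : (fun x => complex.Re (f x * h x)) =
      (fun x => complex.Re (f x) * complex.Re (h x) + (-1) *
        (complex.Im (f x) * complex.Im (h x))).
    by apply/funext => x; rewrite mulN1r; case: (f x) (h x) => [? ?] [? ?].
  by apply: C1_onD; apply: C1_onM => //; [exact: C1_on_cst|exact: C1_onM].
have -> : (fun x => complex.Im (f x * h x)) =
    (fun x => complex.Re (f x) * complex.Im (h x) + complex.Im (f x) *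
      complex.Re (h x)).
  by apply/funext => x; case: (f x) (h x) => [? ?] [? ?].
by apply: C1_onD; apply: C1_onM.
Qed.

Lemma complex_C1_on_sum (I : Type) (r : seq I) (P : pred I)
  (f : I -> 'rV[R]_m -> R[i]) :
  (forall i, P i -> complex_C1_on (f i)) ->
    complex_C1_on (fun x => \sum_(i <- r | P i) f i x).
Proof.
move=> fC; elim: r => [|i r IH].
  by under eq_fun do rewrite big_nil; exact: complex_C1_on_cst.
case: (boolP (P i)) => Pi.
  by under eq_fun do rewrite big_cons Pi; apply: complex_C1_onD => //;
    exact: fC.
by under eq_fun do rewrite big_cons (negPf Pi).
Qed.

Lemma partial_Re_lin (f h : 'rV[R]_m -> R[i]) (c d : R[i]) a x : A x ->
    complex_C1_on f -> complex_C1_on h ->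
  partial a (fun y => complex.Re (c * f y + d * h y)) x =
  complex.Re (c * Complex (partial a (fun y => complex.Re (f y)) x)
                          (partial a (fun y => complex.Im (f y)) x)
            + d * Complex (partial a (fun y => complex.Re (h y)) x)
                          (partial a (fun y => complex.Im (h y)) x)).
Proof.
move=> Ax [fr fi] [hr hi].
have I g : C1_on A g -> is_derive x (delta_mx 0 a) g (partial a g x).
  by move=> /(_ x Ax)[_ /(_ a)[dg _]]; split.
have -> : (fun y => complex.Re (c * f y + d * h y)) =
  (complex.Re c *: (fun y => complex.Re (f y)) - complex.Im c *:
    (fun y => complex.Im (f y)))
  + (complex.Re d *: (fun y => complex.Re (h y)) - complex.Im d *:
    (fun y => complex.Im (h y))).
  apply/funext => y; rewrite !fctE /=.
  by case: (f y) (h y) c d => [? ?] [? ?] [? ?] [? ?].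
have Z k g (gC : C1_on A g) := is_deriveZ k (I g gC).
have H := is_deriveD (is_deriveB (Z (complex.Re c) _ fr)
  (Z (complex.Im c) _ fi))
                     (is_deriveB (Z (complex.Re d) _ hr)
                       (Z (complex.Im d) _ hi)).
rewrite {1}/partial (@derive_val _ _ _ _ _ _ _ H).
by case: c d {Z H} => [? ?] [? ?].
Qed.

End C1.

Section C1Forms.
Context {R : realType} {n : nat} (A : set 'E[R]_n).
Hypothesis oA : open A.

Lemma C1_wedge (w w' : 'E[R]_n -> ext R n) :
    (forall B, complex_C1_on A (fun x => w x B)) ->
    (forall B, complex_C1_on A (fun x => w' x B)) ->
  forall B, complex_C1_on A (fun x => wedge (w x) (w' x) B).
Proof.
move=> wC wC' B; under eq_fun do rewrite ffunE.
apply: complex_C1_on_sum => // D _; apply: complex_C1_onM => //.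
by apply: complex_C1_onM => //; exact: complex_C1_on_cst.
Qed.

Lemma C1_wedge_pow (w : 'E[R]_n -> ext R n) k :
  (forall B, complex_C1_on A (fun x => w x B)) ->
  forall B, complex_C1_on A (fun x => wedge_pow k (w x) B).
Proof.
move=> wC; elim: k => [|k IH] B; first exact: complex_C1_on_cst.
exact: C1_wedge.
Qed.

Lemma C1_fundamental_form (g : 'E[R]_n -> 'M[R]_(n + n)) :
  (forall a b, C1_on A (fun x => g x a b)) ->
  forall B, complex_C1_on A (fun x => fundamental_form (g x) B).
Proof.
move=> gC B.
have -> : (fun x => fundamental_form (g x) B) = (fun x => 2^-1 * \sum_a \sum_b
    Complex (\sum_c Jmx n a c * g x c b) 0 *
      (wedge (dreal a) (dreal b) : ext R n) B).
  apply/funext => x; rewrite /fundamental_form ffunE /GRing.scale /= sum_ffunE;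
    congr (_ * _).
  apply: eq_bigr => a _; rewrite sum_ffunE; apply: eq_bigr => b _.
  by rewrite ffunE mxE.
apply: complex_C1_onM => //; first exact: complex_C1_on_cst.
apply: complex_C1_on_sum => // a _; apply: complex_C1_on_sum => // b _.
apply: complex_C1_onM => //; last exact: complex_C1_on_cst.
have -> : (fun x => Complex (\sum_c Jmx n a c * g x c b) 0) =
    (fun x => \sum_c (Complex (Jmx n a c) 0 * Complex (g x c b) 0)).
  apply/funext => x; rewrite -[LHS]/((\sum_c Jmx n a c * g x c b)%:C%C)
    rmorph_sum.
  by apply: eq_bigr => c _; rewrite rmorphM.
apply: complex_C1_on_sum => // c _; apply: complex_C1_onM => //;
  first exact: complex_C1_on_cst.
by split; [exact: gC|exact: C1_on_cst].
Qed.

End C1Forms.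

Section Multipliers.
Context {R : realType} {K : fieldExtType rat} {s t : nat}.
Context (sigma : 'I_(s + t + t) -> {rmorphism K -> R[i]}).
Context (emb : embeddings_of_type sigma).
Context (U : set K) (adm : admissible sigma U).
Local Notation n := (s + t)%N.
Local Notation I := 'I_(n + n).

Definition real_embedding (j : 'I_s) (u : K) : R :=
  complex.Re (sigma (lshift t (lshift t j)) u).

Lemma real_embeddingE j u : sigma (lshift t (lshift t j)) u =
  (real_embedding j u)%:C%C.
Proof. by apply/eqP; rewrite eq_complex /= (sigma_real emb) !eqxx. Qed.

Lemma real_embedding_gt0 j u : U u -> 0 < real_embedding j u.
Proof.
by case: adm => Utpu _ _ _ _ /Utpu[_ _ _ /(_ j)]; rewrite real_embeddingE ltcR.
Qed.

Lemma multiplier_lshift j u : multiplier sigma u (lshift n (lshift t j)) =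
  (real_embedding j u)%:C%C.
Proof. by rewrite /multiplier (unsplitK (inl _)) real_embeddingE. Qed.

Lemma multiplier_rshift j u : multiplier sigma u (rshift n (lshift t j)) =
  (real_embedding j u)%:C%C.
Proof.
by rewrite /multiplier (unsplitK (inr _)) real_embeddingE conjc_real.
Qed.

(** Each real embedding occurs twice among the multipliers, through dz and through dzbar, and each
    non-real one once. Removing one full set of embeddings, whose product is the norm 1, leaves each
    real embedding once. The norm is positive because the non-real embeddings come in conjugate
    pairs. *)
Lemma prod_multiplier u : U u ->
  \prod_k multiplier sigma u k = (\prod_j real_embedding j u)%:C%C.
Proof.
move=> Uu; have [u0 iu iu'] : [/\ u != 0, alg_integer u & alg_integer u^-1].
  by case: adm => Utpu _ _ _ _; have [] := Utpu u Uu.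
have [inj surj _ _ cj] := emb.
have sE : \prod_i sigma i u = (\prod_(j < s) sigma (lshift t (lshift t j)) u) *
    (\prod_(k < t) sigma (lshift t (rshift s k)) u) *
    (\prod_(k < t) conjc (sigma (lshift t (rshift s k)) u)).
  rewrite big_split_ord big_split_ord /=; congr (_ * _).
  by apply: eq_bigr => k _; rewrite cj.
have N1 : \prod_i sigma i u = 1.
  apply: norm_unit => //; rewrite sE -mulrA -big_split /= mulr_gt0 //.
    by apply: prodr_gt0 => j _; rewrite real_embeddingE ltcR real_embedding_gt0.
  apply: prodr_gt0 => k _; rewrite -[conjc _]/(Num.conj _) -normCK exprn_gt0 //
    normr_gt0.
  by rewrite fmorph_eq0.
rewrite big_split_ord /=.
have -> : \prod_(i < n) multiplier sigma u (lshift n i) = \prod_(i < n) sigma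
  (lshift t i) u.
  by apply: eq_bigr => i _; rewrite /multiplier (unsplitK (inl _)).
have -> : \prod_(i < n) multiplier sigma u (rshift n i) = \prod_(i < n) conjc
  (sigma (lshift t i) u).
  by apply: eq_bigr => i _; rewrite /multiplier (unsplitK (inr _)).
rewrite [X in _ * X]big_split_ord big_split_ord /=.
rewrite mulrCA -sE N1 mulr1 rmorph_prod; apply: eq_bigr => j _.
by rewrite real_embeddingE conjc_real.
Qed.

Lemma prod_multiplier_setD u (q x : I) : x != q ->
  multiplier sigma u q * multiplier sigma u x *
    \prod_(k in (~: [set q] :\ x)%SET) multiplier sigma u k =
  \prod_k multiplier sigma u k.
Proof.
move=> xq; rewrite [RHS](bigD1 q) //= [X in _ = _ * X](bigD1 x) //= mulrA;
  congr (_ * _).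
by apply: eq_bigl => k; rewrite !inE andbC.
Qed.

Lemma set_bidegree m (j : 'I_m) :
  (~: [set rshift m j] :\ lshift m j)%SET = bidegree_set (lift j) (lift j).
Proof.
apply/setP => k; rewrite !inE -[k]splitK; case: (fintype.split k) => i /=.
  rewrite (inj_eq (@lshift_inj _ _)) eq_lrshift andbT.
  apply/idP/orP => [ij|[] /imsetP[l _]].
  - left; case: (unliftP j i) ij => [l ->|->]; last by rewrite eqxx.
    by move=> _; exact: (imset_f (fun l => lshift m (lift j l))).
  - by move/lshift_inj => ->; rewrite eq_sym neq_lift.
  - by move/eqP; rewrite eq_lrshift.
rewrite (inj_eq (@rshift_inj _ _)) eq_rlshift /=.
apply/idP/orP => [ij|[] /imsetP[l _]].
- right; case: (unliftP j i) ij => [l ->|->]; last by rewrite eqxx.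
  by move=> _; exact: (imset_f (fun l => rshift m (lift j l))).
- by move/eqP; rewrite eq_rlshift.
- by move/rshift_inj => ->; rewrite eq_sym neq_lift.
Qed.

End Multipliers.

Section Field.
Context {R : realType} {K : fieldExtType rat} {s t : nat}.
Context (sigma : 'I_(s + t + t) -> {rmorphism K -> R[i]}).
Context (emb : embeddings_of_type sigma).
Context (U : set K) (adm : admissible sigma U).
Local Notation n := (s + t)%N.
Local Notation I := 'I_(n + n).
Local Notation E := ('rV[R]_(n + n)).
Local Notation act := (ot_act sigma).
Local Notation M := (@ot_cover R s t).
Local Notation G := (ot_group U).
Variables (j0 : 'I_s) (W al : E -> ext R n) (k0 : R[i]).
Hypothesis W_C1 : forall B, complex_C1_on M (fun z => W z B).
Hypothesis al_C1 : forall B, complex_C1_on M (fun z => al z B).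
Hypothesis W_al : forall z, M z -> del W z = delbar al z.
Hypothesis W_act : forall h z, G h -> M z ->
  W z = rescale (multiplier sigma h.2) (W (act h z)).
Hypothesis al_act : forall h z, G h -> M z ->
  al z = rescale (multiplier sigma h.2) (al (act h z)).
Hypothesis W_pos : forall z, M z ->
  0 < k0 * W z (bidegree_set (lift (lshift t j0)) (lift (lshift t j0))).

Let q : I := rshift n (lshift t j0).
Let T : {set I} := (~: [set q])%SET.
Let eps j : R[i] := shuffle_sign [set lshift n j]%SET (T :\ lshift n j)%SET.
Let eps' j : R[i] := (rshift n j \in T)%:R
  * shuffle_sign [set rshift n j]%SET (T :\ rshift n j)%SET.
Let k := k0 * eps (lshift t j0).

(** Expanding the Wirtinger derivatives, these are the coefficients of the real partial derivatives
    in 2 (- i k) times the coefficient of del W - delbar al at [T]. The sign in [k] makes [coefW q]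
    equal to - k0. *)
Let coefW (a : I) := match fintype.split a with
  | inl j => - 'i%C * k * eps j | inr j => 'i%C * 'i%C * k * eps j end.
Let coefal (a : I) := match fintype.split a with
  | inl j => 'i%C * k * eps' j | inr j => 'i%C * 'i%C * k * eps' j end.
Let setW (a : I) := match fintype.split a with
  | inl j => (T :\ lshift n j)%SET | inr j => (T :\ lshift n j)%SET end.
Let setal (a : I) := match fintype.split a with
  | inl j => (T :\ rshift n j)%SET | inr j => (T :\ rshift n j)%SET end.

(* Up to a constant factor, the vector field dual to the real part of the
   (2n - 1)-form dzbar_q /\ (W - al), where al has been cut to its part of the
   right bidegree. *)
Definition dual_field (a : I) (z : E) : R :=
  complex.Re (coefW a * W z (setW a) + coefal a * al z (setal a)).

Lemma dual_field_C1 a : C1_on M (dual_field a).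
Proof.
have oM := @ot_cover_open R s t.
have [] // := complex_C1_onD oM
  (complex_C1_onM oM (complex_C1_on_cst M (coefW a)) (W_C1 (setW a)))
  (complex_C1_onM oM (complex_C1_on_cst M (coefal a)) (al_C1 (setal a))).
Qed.

(* The coefficient of del W = delbar al at all indices but dzbar_q. *)
Lemma dual_field_divergence z : M z -> \sum_a partial a (dual_field a) z = 0.
Proof.
move=> Mz.
have pE a : partial a (dual_field a) z = complex.Re
    (coefW a * cpartial a (fun y => W y (setW a)) z + coefal a * cpartial a
      (fun y => al y (setal a)) z).
  exact: (partial_Re_lin _ _ _ Mz (W_C1 _) (al_C1 _)).
pose X j := eps j * (cpartial (lshift n j) (fun y => W y (T :\ lshift n j)%SET)
  z
                     - 'i%C * cpartial (rshift n j)
                         (fun y => W y (T :\ lshift n j)%SET) z).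
pose X' j := eps' j *
  (cpartial (lshift n j) (fun y => al y (T :\ rshift n j)%SET) z
                     + 'i%C * cpartial (rshift n j)
                       (fun y => al y (T :\ rshift n j)%SET) z).
have eqX : \sum_j X j = \sum_j X' j.
  have h2 : (2^-1 : R[i]) != 0 by rewrite invr_eq0 pnatr_eq0.
  apply: (mulfI h2); rewrite !mulr_sumr.
  have e : del W z T = delbar al z T by rewrite (W_al Mz).
  have {}e := etrans (esym (delE W z T)) (etrans e (delbarE al z T)).
  apply: etrans (etrans _ e) _; apply: eq_bigr => j _.
    have -> : lshift n j \in T by rewrite !inE eq_lrshift.
    by rewrite mul1r mulrCA; congr (_ * _); rewrite !ffunE.
  by rewrite mulrCA; congr (_ * _); rewrite !ffunE.
rewrite big_split_ord /= -big_split /=.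
transitivity (\sum_j complex.Re (- 'i%C * k * (X j - X' j))).
  apply: eq_bigr => j _; rewrite !pE -raddfD; congr complex.Re.
  rewrite /coefW /coefal /setW /setal !(unsplitK (inl j)) !(unsplitK (inr j)) /X
    /X'; ring.
by rewrite -raddf_sum -mulr_sumr sumrB eqX subrr mulr0.
Qed.

(** The term from [al] drops out because [T] does not contain dzbar_q, so [eps'] vanishes there.
    What remains is minus the diagonal coefficient of [W] without the indices of dz and dzbar at
    [j0]. *)
Lemma dual_field_lt0 z : M z -> dual_field q z < 0.
Proof.
move=> Mz; rewrite /dual_field /coefW /coefal /setW /q !(unsplitK (inr _)).
have -> : eps' (lshift t j0) = 0 by rewrite /eps' !inE eqxx mul0r.
have ee : eps (lshift t j0) * eps (lshift t j0) = 1 by rewrite -expr2 sqrr_sign.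
have -> : 'i%C * 'i%C * k * eps (lshift t j0) *
  W z (T :\ lshift n (lshift t j0))%SET +
   'i%C * 'i%C * k * 0 * al z (setal (rshift n (lshift t j0))) =
   - (k0 * W z (T :\ lshift n (lshift t j0))%SET).
  rewrite mulr0 mul0r addr0 [_ * 'i%C]sqr_i mulN1r !mulNr /k -(mulrA k0) ee
    mulr1 //.
rewrite set_bidegree raddfN oppr_lt0.
by have := W_pos Mz; rewrite ltcE => /andP[].
Qed.

(** The coefficients involved lack dzbar_q and one of dz_j, dzbar_j. The missing multipliers are the
    real numbers on the left for either choice, so the terms from [W] and [al] scale alike, and
    together the multipliers complete the full product. *)
Lemma dual_field_act (j : 'I_s) h z : G h -> M z ->
  real_embedding sigma j0 h.2 * real_embedding sigma j h.2
    * dual_field (rshift n (lshift t j)) z =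
  (\prod_i real_embedding sigma i h.2)
    * dual_field (rshift n (lshift t j)) (act h z).
Proof.
move=> Gh Mz; have Uh : U h.2 by case: Gh.
have ReM (x : R) (y : R[i]) : x * complex.Re y = complex.Re (x%:C%C * y).
  by case: y => y1 y2 /=; rewrite mul0r subr0.
set r := _ * real_embedding sigma j h.2.
rewrite /dual_field !ReM !mulrDr; congr (complex.Re (_ + _)).
  rewrite /setW (unsplitK (inr _)) mulrCA [RHS]mulrCA; congr (_ * _).
  rewrite (W_act Gh Mz) ffunE mulrA; congr (_ * _).
  rewrite -(prod_multiplier emb adm Uh)
    -(@prod_multiplier_setD _ _ _ _ sigma _ q (lshift n (lshift t j))).
    by rewrite /q (multiplier_lshift emb) (multiplier_rshift emb) -rmorphM.
  by rewrite eq_lrshift.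
rewrite /setal /coefal (unsplitK (inr _)) mulrCA [RHS]mulrCA.
(* For j = j0 the set [setal] does not lack a second index, but then the coefficient of [al] is
   zero. *)
have [jq|jq] := eqVneq (rshift n (lshift t j)) q.
  by rewrite /eps' jq !inE eqxx !mul0r mulr0 !mul0r.
congr (_ * _).
rewrite (al_act Gh Mz) ffunE mulrA; congr (_ * _).
rewrite -(prod_multiplier emb adm Uh)
  -(@prod_multiplier_setD _ _ _ _ sigma _ q _ jq).
by rewrite /q !(multiplier_rshift emb) -rmorphM.
Qed.

Lemma dual_fieldE a : exists c d B B', forall z,
  dual_field a z = complex.Re (c * W z B + d * al z B').
Proof. by exists (coefW a), (coefal a), (setW a), (setal a). Qed.

End Field.

(** * Logarithmic coordinates *)

Section LogCoordinates.
Context {R : realType} {m : nat} (P : pred 'I_m) (q : 'I_m).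
Local Notation V := 'rV[R]_m.

Definition orthant : set V := [set z | forall b, P b -> 0 < z 0 b].

Definition exp_coords (x : V) : V :=
  \row_b (if P b then expR (x 0 b) else x 0 b).

(* log_field is v / y_q with respect to the coordinates log y_b, where P b, and
   the other coordinates as they are; exp (sum_b x_b) is the Jacobian. *)
Definition log_weight (a : 'I_m) (x : V) : R :=
  \sum_(b | P b) x 0 b - x 0 q - (P a)%:R * x 0 a.

Lemma exp_coords_orthant x : orthant (exp_coords x).
Proof. by move=> b Pb; rewrite mxE Pb expR_gt0. Qed.

Lemma coord_cont (b : 'I_m) : continuous (fun x : V => x 0 b).
Proof. exact: coord_continuous. Qed.

Lemma exp_coords_continuous : continuous exp_coords.
Proof.
apply: rV_continuous => b; rewrite /exp_coords.
under eq_fun do rewrite mxE; case: (P b); last exact: coord_cont.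
by move=> x; apply: (@continuous_comp _ _ _ (fun x : V => x 0 b) expR);
  [exact: coord_cont|exact: continuous_expR].
Qed.

Lemma log_weight_continuous a : continuous (log_weight a).
Proof.
have S : continuous (fun x : V => \sum_(b | P b) x 0 b).
  elim: (index_enum _) => [|b s IH] x.
    by rewrite (_ : (fun x : V => _) = fun=> 0);
      [exact: cst_continuous|apply/funext => y; rewrite big_nil].
  case: (boolP (P b)) => Pb.
    rewrite (_ : (fun x : V => _) =
      (fun x => x 0 b + \sum_(c <- s | P c) x 0 c)).
      exact: (continuousD (@coord_cont b x) (IH x)).
    by apply/funext => y; rewrite big_cons Pb.
  rewrite (_ : (fun x : V => _) = (fun x => \sum_(c <- s | P c) x 0 c));
    first exact: IH.
  by apply/funext => y; rewrite big_cons (negPf Pb).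
move=> x; rewrite /log_weight.
have cst c : {for x, continuous (fun z : V => c : R)} by exact: cst_continuous.
exact: (continuousB (continuousB (S x) (@coord_cont q x))
  (continuousM (cst _) (@coord_cont a x))).
Qed.

(** Along direction [a] the sum over [P] and the subtracted x_a compensate each other; only x_q is
    left, and only for a = q. This derivative is the source of the positive divergence. *)
Lemma log_weight_upd a x r :
  log_weight a (upd x a r) = log_weight a x - (a == q)%:R * (r - x 0 a).
Proof.
rewrite /log_weight !mxE eqxx.
have -> : \sum_(b | P b) upd x a r 0 b = \sum_(b | P b) x 0 b + (P a)%:R *
  (r - x 0 a).
  have E b : upd x a r 0 b = x 0 b + (b == a)%:R * (r - x 0 a).
    by rewrite mxE; case: eqP => [->|_];
      rewrite ?mul0r ?addr0 // mul1r addrC subrK.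
  under eq_bigr do rewrite E; rewrite big_split /=; congr (_ + _).
  have [Pa|NPa] := boolP (P a).
    by rewrite (bigD1 a) //= eqxx big1 ?addr0 // => b /andP[_ /negPf ->];
      rewrite mul0r.
  by rewrite mul0r big1 // => b Pb; case: eqP NPa => [<-|];
    rewrite ?Pb // mul0r.
by have [->|aq] := eqVneq a q; rewrite /= ?mulr1n ?mulr0n; ring.
Qed.

Lemma derivable_is_derive_line (f : V -> R) (z e : V) : derivable f z e ->
  is_derive (0 : R) (1 : R) (fun r => f (z + r *: e)) ('D_e f z).
Proof.
move=> df.
have E : (fun h : R => h^-1 *:
  (((fun r => f (z + r *: e)) \o shift 0) (h *: 1) - f (z + 0 *: e)))
   = (fun h => h^-1 *: ((f \o shift z) (h *: e) - f z)).
  by apply/funext => h /=; rewrite scale0r !addr0 [h *: 1]mulr1 [z + _]addrC.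
by split; [rewrite /derivable E|rewrite /derive E].
Qed.

Variable v : 'I_m -> V -> R.
Hypothesis vC : forall a, C1_on orthant (v a).

Definition log_field a x := expR (log_weight a x) * v a (exp_coords x).

Definition log_field_deriv a x := expR (log_weight a x) *
  (- (a == q)%:R * v a (exp_coords x) +
   (if P a then expR (x 0 a) else 1) * partial a (v a) (exp_coords x)).

Lemma log_field_is_derive a (x : V) :
  is_derive (x 0 a) (1 : R) (fun r => log_field a (upd x a r))
    (log_field_deriv a x).
Proof.
have [_ /(_ a)[dv _]] := vC a (exp_coords_orthant x).
pose th r : R := if P a then expR r else r.
pose th' : R := if P a then expR (x 0 a) else 1.
have thD : is_derive (x 0 a) (1 : R) (fun r => th r - th (x 0 a)) th'.
  rewrite -[th']subr0 /th /th'; case: (P a); apply: is_deriveB.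
(* Changing one logarithmic coordinate moves the image along a straight line in direction [a], so
   the chain rule leads back to a partial derivative. *)
have uE r : exp_coords (upd x a r) = exp_coords x + (th r - th (x 0 a)) *:
  delta_mx 0 a.
  apply/rowP => b; rewrite !mxE /th eqxx /=; have [->|ba] := eqVneq b a.
    by case: (P a); rewrite mulr1 addrC subrK.
  by rewrite mulr0 addr0.
have vD : is_derive (x 0 a) (1 : R) (fun r => v a (exp_coords (upd x a r)))
    (th' * partial a (v a) (exp_coords x)).
  under eq_fun do rewrite uE.
  have := derivable_is_derive_line dv;
    rewrite -/(partial a (v a) (exp_coords x)).
  rewrite -(subrr (th (x 0 a))) => D0.
  have := is_derive1_comp (f := fun r => v a (exp_coords x + r *: delta_mx 0 a))
    (g := fun r => th r - th (x 0 a)) D0 thD.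
  by rewrite mulrC.
have eD : is_derive (x 0 a) (1 : R) (fun r => expR (log_weight a (upd x a r)))
    (expR (log_weight a x) * - (a == q)%:R).
  have lD : is_derive (x 0 a) (1 : R) (fun r => log_weight a (upd x a r))
    (- (a == q)%:R).
    under eq_fun do rewrite log_weight_upd.
    have := is_deriveB (is_derive_cst (log_weight a x) (x 0 a) (1 : R))
      (is_deriveZ ((a == q)%:R : R)
        (is_deriveB (is_derive_id (x 0 a) (1 : R))
          (is_derive_cst (x 0 a) (x 0 a) (1 : R)))).
    by rewrite subr0 sub0r /GRing.scale /= mulr1.
  have := is_derive1_comp (f := expR) (g := fun r => log_weight a (upd x a r))
    (is_derive_expR _) lD.
  by rewrite upd_id.
have := is_deriveM eD vD; rewrite upd_id /log_field_deriv /GRing.scale /=.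
by congr is_derive; rewrite -/th'; ring.
Qed.

Lemma log_field_deriv_continuous a : continuous (log_field_deriv a).
Proof.
move=> x; have [vc /(_ a)[_ pc]] := vC a (exp_coords_orthant x).
have ec := @exp_coords_continuous x.
have c1 : {for x, continuous (fun y => v a (exp_coords y))}
  by exact: (continuous_comp ec vc).
have c2 : {for x, continuous (fun y => partial a (v a) (exp_coords y))}
  by exact: (continuous_comp ec pc).
have c3 : {for x, continuous (fun y : V => if P a then expR (y 0 a) else 1)}.
  case: (P a); last exact: cst_continuous.
  by apply: (@continuous_comp _ _ _ (fun x : V => x 0 a) expR);
    [exact: coord_cont|exact: continuous_expR].
have c4 : {for x, continuous (fun y : V => expR (log_weight a y))}.
  by apply: (@continuous_comp _ _ _ (log_weight a) expR);
    [exact: log_weight_continuous|exact: continuous_expR].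
have cst c : {for x, continuous (fun z : V => c : R)} by exact: cst_continuous.
exact: (continuousM c4
  (continuousD (continuousM (cst _) c1) (continuousM c3 c2))).
Qed.

Lemma sum_log_field_deriv (x : V) : \sum_a partial a (v a) (exp_coords x) = 0 ->
  \sum_a log_field_deriv a x = - (expR (log_weight q x) * v q (exp_coords x)).
Proof.
move=> div0; pose S := expR (\sum_(b | P b) x 0 b - x 0 q).
have E a : log_field_deriv a x = -
  ((a == q)%:R * (expR (log_weight a x) * v a (exp_coords x)))
    + S * partial a (v a) (exp_coords x).
  rewrite /log_field_deriv mulrDr; congr (_ + _); first by ring.
  rewrite mulrA; congr (_ * _); rewrite /S /log_weight; case: (P a).
    by rewrite -expRD mul1r subrK.
  by rewrite mul0r subr0 mulr1.
under eq_bigr do rewrite E.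
rewrite big_split /= -mulr_sumr div0 mulr0 addr0 (bigD1 q) //= eqxx mul1r big1
  ?addr0 //.
by move=> a /negPf ->; rewrite mul0r oppr0.
Qed.

End LogCoordinates.

(** * Bounds from cocompactness *)

Lemma compact_bounds (R : realType) m (A : set 'rV[R]_m) (f : 'rV[R]_m -> R) :
    compact A -> A !=set0 -> (forall z, A z -> {for z, continuous f}) ->
  exists z1 z2, [/\ A z1, A z2 & forall z, A z -> f z1 <= f z <= f z2].
Proof.
move=> cA A0 fc; have wc : {within A, continuous f}.
  by apply: continuous_in_subspaceT => z /set_mem; exact: fc.
have [z1 z1A h1] := compact_EVT_min A0 cA wc;
  have [z2 z2A h2] := compact_EVT_max A0 cA wc.
exists z1, z2; split; [exact: set_mem|exact: set_mem|move=> z Az].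
by rewrite h1 ?h2 // inE.
Qed.

Section Bounds.
Context {R : realType} {K : fieldExtType rat} {s t : nat}.
Context (sigma : 'I_(s + t + t) -> {rmorphism K -> R[i]}).
Context (emb : embeddings_of_type sigma).
Context (U : set K) (adm : admissible sigma U).
Local Notation n := (s + t)%N.
Local Notation I := 'I_(n + n).
Local Notation E := ('rV[R]_(n + n)).
Local Notation act := (ot_act sigma).
Local Notation M := (@ot_cover R s t).
Local Notation G := (ot_group U).

Definition height (j : 'I_s) (z : E) : R := z 0 (rshift n (lshift t j)).

Lemma height_act g z j : G g ->
  height j (act g z) = real_embedding sigma j g.2 * height j z.
Proof. by move=> Gg; have := Im_act emb z j Gg. Qed.

Lemma height_continuous j : continuous (height j).
Proof. exact: coord_continuous. Qed.

Definition base_point : E := \row_b (if fintype.split b is inr j then 1 else 0).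

Lemma base_point_cover : M base_point.
Proof. by move=> j /=; rewrite mxE (unsplitK (inr _)). Qed.

Lemma fundamental_compact : exists C : set E,
  [/\ compact C, C !=set0, C `<=` M &
  forall z, M z -> exists2 g, G g & C (act g z)].
Proof.
case: adm => _ _ _ _ [C [cC CM] CG]; exists C; split => //.
by have [g _ Cg] := CG _ base_point_cover; exists (act g base_point).
Qed.

(** The bounds are attained, so a strict sign of [f] at every point of the cover becomes a uniform
    gap. *)
Lemma invariant_bounds (f : E -> R) :
    (forall z, M z -> {for z, continuous f}) ->
    (forall g z, G g -> M z -> f z = f (act g z)) ->
  exists z1 z2, [/\ M z1, M z2 & forall z, M z -> f z1 <= f z <= f z2].
Proof.
move=> fc fG; have [C [cC C0 CM CG]] := fundamental_compact.
have [z1 [z2 [Cz1 Cz2 h]]] := compact_bounds cC C0 (fun z Cz => fc z (CM z Cz)).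
exists z1, z2; split; [exact: CM|exact: CM|move=> z Mz].
by have [g Gg Cgz] := CG z Mz; rewrite (fG g z Gg Mz); exact: h.
Qed.

(* Multiplication by such a u maps the point (i, .., i, 0, .., 0) into a fixed
   compact set. *)
Lemma finite_bounded_units (lo hi : 'I_s -> R) : (forall j, 0 < lo j) ->
  exists sq : seq K, forall u, U u ->
    (forall j, lo j <= real_embedding sigma j u <= hi j) -> u \in sq.
Proof.
move=> lo0.
pose J (b : I) : set R := if fintype.split b is inr k then
    if fintype.split k is inl j then
      `[Num.min 1 (lo j), Num.max 1 (hi j)]%classic else `[0, 0]%classic
  else `[0, 0]%classic.
have JC b : compact (J b).
  rewrite /J; case: (fintype.split b) => k; last case: (fintype.split k) => j;
    exact: segment_compact.
pose C : set E := [set z | forall b, J b (z 0 b)].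
have cC : compact C by exact: (rV_compact JC).
have CM : C `<=` M.
  move=> z Cz j; have := Cz (rshift n (lshift t j));
    rewrite /J (unsplitK (inr _)) (unsplitK (inl _)) /=.
  by rewrite in_itv /= => /andP[h _]; apply: lt_le_trans h;
    rewrite lt_min ltr01 lo0.
have [_ _ _ /(_ C cC CM) /finite_seqP[sq sqE] _] := adm.
exists [seq g.2 | g <- sq] => u Uu ub; apply/mapP; exists (0, u) => //.
pose z0 : E := \row_b (if fintype.split b is inr k then
   if fintype.split k is inl j then 1 else 0 else 0).
have Cz0 : C z0.
  move=> b; rewrite /J /z0 mxE; case: (fintype.split b) => k;
    last case: (fintype.split k) => j;
   by rewrite /= in_itv /= ?lexx // ge_min le_max lexx.
have z0E j : zcoord z0 j = if fintype.split j is inl _ then 'i%C else 0.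
  rewrite /zcoord !mxE (unsplitK (inl _)) (unsplitK (inr _)).
  by case: (fintype.split j).
suff Cz : C (act (0, u) z0).
  suff : [set` sq] (0, u) by [].
  rewrite -sqE; split; first by split => //;
    exact: (mxpoly.integral0 (intr : {rmorphism int -> K})).
  by exists (act (0, u) z0); split => //; exists z0.
have aE j : zcoord (act (0, u) z0) j =
    if fintype.split j is inl i then Complex 0 (real_embedding sigma i u) else
      0.
  rewrite zcoord_act /= rmorph0 addr0 z0E -[j]splitK unsplitK.
  case: (fintype.split j) => i /=; last by rewrite mulr0.
  rewrite (real_embeddingE emb); apply/eqP; rewrite eq_complex /=; apply/andP;
    split; apply/eqP; ring.
move=> b; rewrite -[b]splitK; case: (fintype.split b) => k /=.
  rewrite /J (unsplitK (inl _)) /= in_itv /=.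
  have -> : act (0, u) z0 0 (lshift n k) = complex.Re (zcoord (act (0, u) z0) k)
    by [].
  by rewrite aE; case: (fintype.split k) => ? /=; rewrite lexx.
have -> : act (0, u) z0 0 (rshift n k) = complex.Im (zcoord (act (0, u) z0) k)
  by [].
rewrite aE /J (unsplitK (inr _)); case: (fintype.split k) => j /=;
  rewrite in_itv /= ?lexx //.
by have /andP[l h] := ub j; rewrite ge_min l orbT le_max h orbT.
Qed.

(** The translation part of the group element does not affect the multipliers, so finiteness of the
    set of units is enough although infinitely many translations occur. *)
Lemma strip_bounded (w : E -> ext R n) (c : R[i]) (B : {set I}) (T : R) :
  1 <= T ->
    (forall D, complex_C1_on M (fun z => w z D)) ->
    (forall h z, G h -> M z -> w z = rescale (multiplier sigma h.2)
      (w (act h z))) ->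
  exists2 b, 0 <= b & forall z, M z -> (forall j, 1 <= height j z <= T) ->
    `|complex.Re (c * w z B)| <= b.
Proof.
move=> T1 wC wG; have [C [cC C0 CM CG]] := fundamental_compact.
have /choice[lo loP] : forall j, exists l : R, 0 < l /\ forall z, C z ->
  l <= height j z.
  move=> j; have [z1 [z2 [Cz1 _ h]]] :=
    compact_bounds cC C0 (fun z _ => @height_continuous j z).
  exists (height j z1); split; first exact: (CM _ Cz1).
  by move=> z /h/andP[].
have /choice[hi hiP] : forall j, exists l : R, forall z, C z -> height j z <= l.
  move=> j; have [z1 [z2 [Cz1 _ h]]] :=
    compact_bounds cC C0 (fun z _ => @height_continuous j z).
  by exists (height j z2) => z /h/andP[].
(* The embedding of the unit is the quotient of the heights after and before the move; the latter
   lie between 1 and T. *)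
have [sq sqP] := @finite_bounded_units (fun j => lo j / T) hi
  (fun j => divr_gt0 (loP j).1 (lt_le_trans ltr01 T1)).
have /choice[b bP] : forall u : K, exists b : R, 0 <= b /\ forall z, C z ->
    `|complex.Re (c * ((\prod_(k in B) multiplier sigma u k) * w z B))| <= b.
  move=> u; pose f z :=
    complex.Re (c * ((\prod_(k in B) multiplier sigma u k) * w z B)).
  have oM := @ot_cover_open R s t.
  have [fC _] := complex_C1_onM oM (complex_C1_on_cst M c)
    (complex_C1_onM oM (complex_C1_on_cst M
      (\prod_(k in B) multiplier sigma u k)) (wC B)).
  have [z1 [z2 [_ _ h]]] :=
    compact_bounds cC C0 (fun z Cz => (fC z (CM z Cz)).1).
  exists (`|f z1| + `|f z2|); split; first by rewrite addr_ge0.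
  move=> z /h/andP[h1 h2]; rewrite -/(f z) ler_norml; apply/andP; split.
    apply: le_trans h1; have := ler_norm (- f z1); have := normr_ge0 (f z2);
      rewrite normrN.
    by move=> ? ?; lra.
  apply: le_trans h2 _; have := ler_norm (f z2); have := normr_ge0 (f z1).
  by move=> ? ?; lra.
exists (\sum_(u <- sq) b u); first by rewrite sumr_ge0 // => u _;
  exact: (bP u).1.
move=> z Mz zT; have [g Gg Cgz] := CG z Mz.
have usq : g.2 \in sq.
  apply: sqP; first by case: Gg.
  move=> j; have := (loP j).2 _ Cgz; have := hiP j _ Cgz;
    rewrite height_act // => h1 h2.
  have /andP[z1 zT'] := zT j; have re0 := real_embedding_gt0 emb adm j Gg.2.
  rewrite ler_pdivrMr ?(lt_le_trans ltr01) //; apply/andP; split.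
    by apply: (le_trans h2); rewrite ler_pM2l.
  by apply: le_trans h1; rewrite ler_pMr.
rewrite (wG g z Gg Mz) ffunE; apply: le_trans ((bP g.2).2 _ Cgz) _.
rewrite (perm_big _ (perm_to_rem usq)) big_cons /= lerDl sumr_ge0 // => u _;
  exact: (bP u).1.
Qed.

End Bounds.

(** * The choice of the box and the contradiction *)

Section Contradiction.
Context {R : realType} {K : fieldExtType rat} {s t : nat}.
Context (sigma : 'I_(s + t + t) -> {rmorphism K -> R[i]}).
Context (s_gt0 : (0 < s)%N) (emb : embeddings_of_type sigma).
Context (U : set K) (adm : admissible sigma U).
Local Notation n := (s + t)%N.
Local Notation I := 'I_(n + n).
Local Notation E := ('rV[R]_(n + n)).
Local Notation act := (ot_act sigma).
Local Notation M := (@ot_cover R s t).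
Local Notation G := (ot_group U).

Let j0 : 'I_s := Ordinal s_gt0.
Let q : I := rshift n (lshift t j0).

Definition is_height (b : I) : bool :=
  if fintype.split b is inr k then
    if fintype.split k is inl _ then true else false
  else false.

Lemma is_height_rshift (j : 'I_s) : is_height (rshift n (lshift t j)).
Proof. by rewrite /is_height (unsplitK (inr _)) (unsplitK (inl _)). Qed.

Lemma is_heightP (b : I) : is_height b -> exists j, b = rshift n (lshift t j).
Proof.
rewrite /is_height -{2}[b]splitK; case: (fintype.split b) => // k /=.
by rewrite -{2}[k]splitK; case: (fintype.split k) => // j _; exists j.
Qed.

Lemma orthant_is_height : orthant is_height = M.
Proof.
apply/seteqP; split => z zP; last by move=> b /is_heightP[j ->]; exact: zP.
by move=> j; exact: (zP _ (is_height_rshift j)).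
Qed.

Lemma sum_is_height (f : I -> R) :
  \sum_(b | is_height b) f b = \sum_(j < s) f (rshift n (lshift t j)).
Proof.
rewrite big_split_ord /= big_pred0 ?add0r; last by move=> k;
  rewrite /is_height (unsplitK (inl _)).
rewrite big_split_ord /= [X in _ + X]big_pred0 ?addr0; last first.
  by move=> k; rewrite /is_height (unsplitK (inr _)) (unsplitK (inr _)).
by apply: eq_bigl => j; rewrite is_height_rshift.
Qed.

Definition height_weight (j : 'I_s) (z : E) : R :=
  (\prod_i height i z) * (height j0 z * height j z)^-1.

Lemma log_weight_height (j : 'I_s) (x : E) :
  expR (log_weight is_height q (rshift n (lshift t j)) x) =
  height_weight j (exp_coords is_height x).
Proof.
have hE i : height i (exp_coords is_height x) =
  expR (x 0 (rshift n (lshift t i))).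
  by rewrite /height mxE is_height_rshift.
rewrite /log_weight is_height_rshift mul1r -addrA -opprD expRD expRN
  sum_is_height.
rewrite expR_sum expRD /height_weight !hE; congr (_ * _).
by apply: eq_bigr => i _; rewrite hE.
Qed.

Lemma height_weight_gt0 j z : M z -> 0 < height_weight j z.
Proof.
move=> Mz; have h i : 0 < height i z by exact: Mz.
by rewrite mulr_gt0 ?invr_gt0 ?mulr_gt0 // prodr_gt0.
Qed.

Lemma height_weight_continuous j z : M z ->
  {for z, continuous (height_weight j)}.
Proof.
move=> Mz; have h i : 0 < height i z by exact: Mz.
have cprod : continuous (fun z : E => \prod_(i < s) height i z).
  elim: (index_enum _) => [|i r IH] y.
    by rewrite (_ : (fun z : E => _) = fun=> 1);
      [exact: cst_continuous|apply/funext => x; rewrite big_nil].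
  rewrite (_ : (fun z : E => _) =
    (fun z => height i z * \prod_(i <- r) height i z)).
    exact: (continuousM (@height_continuous _ _ _ i y) (IH y)).
  by apply/funext => x; rewrite big_cons.
have cden : {for z, continuous (fun z : E => height j0 z * height j z)}.
  exact: (continuousM (@height_continuous _ _ _ j0 z)
    (@height_continuous _ _ _ j z)).
apply: (continuousM (cprod z)); apply: (continuousV _ cden).
by rewrite mulf_neq0 // gt_eqF.
Qed.

Variables (W al : E -> ext R n) (k0 : R[i]).
Hypothesis W_C1 : forall B, complex_C1_on M (fun z => W z B).
Hypothesis al_C1 : forall B, complex_C1_on M (fun z => al z B).
Hypothesis W_al : forall z, M z -> del W z = delbar al z.
Hypothesis W_act : forall h z, G h -> M z ->
  W z = rescale (multiplier sigma h.2) (W (act h z)).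
Hypothesis al_act : forall h z, G h -> M z ->
  al z = rescale (multiplier sigma h.2) (al (act h z)).
Hypothesis W_pos : forall z, M z ->
  0 < k0 * W z (bidegree_set (lift (lshift t j0)) (lift (lshift t j0))).

Let v := dual_field j0 W al k0.
Let vC a : C1_on M (v a).
Proof. exact: dual_field_C1. Qed.

Let phi j z := height_weight j z * v (rshift n (lshift t j)) z.

Let phi_continuous j z : M z -> {for z, continuous (phi j)}.
Proof.
move=> Mz; have [vc _] := vC (rshift n (lshift t j)) Mz.
exact: (continuousM (@height_weight_continuous j z Mz) vc).
Qed.

(** The weight scales by the product of the real embeddings over those at [j0] and [j], the inverse
    of the factor for the dual field. *)
Let phi_act j h z : G h -> M z -> phi j z = phi j (act h z).
Proof.
move=> Gh Mz; have Uh : U h.2 by case: Gh.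
have r0 i : real_embedding sigma i h.2 != 0 by rewrite gt_eqF //
  (real_embedding_gt0 emb adm).
have h0 i : height i z != 0 by rewrite gt_eqF //; exact: Mz.
have e := dual_field_act emb adm j0 k0 W_act al_act j Gh Mz.
have hE i : height i (act h z) = real_embedding sigma i h.2 * height i z.
  exact: (height_act emb z i Gh).
rewrite /phi /height_weight !hE (eq_bigr _ (fun i _ => hE i)).
rewrite big_split /=.
have -> : (\prod_i real_embedding sigma i h.2 * \prod_i height i z) *
    (real_embedding sigma j0 h.2 * height j0 z *
      (real_embedding sigma j h.2 * height j z))^-1 *
    v (rshift n (lshift t j)) (act h z) =
  \prod_i height i z * (height j0 z * height j z)^-1 *
    (real_embedding sigma j0 h.2 * real_embedding sigma j h.2)^-1 *
  ((\prod_i real_embedding sigma i h.2) * v (rshift n (lshift t j)) (act h z)).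
  by field; rewrite !r0 !h0.
rewrite -e; field; by rewrite !r0 !h0.
Qed.

Lemma no_dual_pair : False.
Proof.
have vC' a : C1_on (orthant is_height) (v a) by rewrite orthant_is_height;
  exact: vC.
have expM x : M (exp_coords is_height x) by rewrite -orthant_is_height;
  exact: exp_coords_orthant.
pose F := log_field is_height q v; pose d := log_field_deriv is_height q v.
have FE j x : F (rshift n (lshift t j)) x = phi j (exp_coords is_height x).
  by rewrite /F /log_field log_weight_height.
(* [c] is minus the maximum of the invariant function [phi j0]; it is positive since that maximum is
   attained on the cover, where [phi j0] is negative. *)
have [c c0 cP] : exists2 c : R, 0 < c & forall x, c <= \sum_a d a x.
  have [z1 [z2 [_ Mz2 h]]] := invariant_bounds adm (@phi_continuous j0)
    (@phi_act j0).
  exists (- phi j0 z2).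
    rewrite oppr_gt0 /phi pmulr_rlt0 ?height_weight_gt0 //.
    exact: dual_field_lt0.
  move=> x; rewrite /d sum_log_field_deriv; last exact: dual_field_divergence.
  by rewrite lerN2 log_weight_height; have /andP[] := h _ (expM x).
have /choice[C1 C1P] : forall a, exists b : R,
  0 <= b /\ (is_height a -> forall x, `|F a x| <= b).
  move=> a; case: (boolP (is_height a)) => [/is_heightP[j ->]|_];
    last by exists 0.
  have [z1 [z2 [_ _ h]]] := invariant_bounds adm (@phi_continuous j)
    (@phi_act j).
  exists (`|phi j z1| + `|phi j z2|); split=> [|_ x]; first by rewrite addr_ge0.
  have /andP[h1 h2] := h _ (expM x); rewrite FE ler_norml; apply/andP; split.
    apply: le_trans h1; have := ler_norm (- phi j z1);
      have := normr_ge0 (phi j z2); rewrite normrN.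
    by move=> ? ?; lra.
  apply: le_trans h2 _; have := ler_norm (phi j z2);
    have := normr_ge0 (phi j z1).
  by move=> ? ?; lra.
pose S1 : R := \sum_a C1 a; have S10 : 0 <= S1 by apply: sumr_ge0 => a _;
  exact: (C1P a).1.
(* The 4 brings the faces in the log directions below c / 2 in total; the 1 keeps [T1] positive when
   the bounds vanish. *)
pose T1 : R := 4 * (S1 + 1) / c;
  have T10 : 0 < T1 by rewrite divr_gt0 // mulr_gt0 // ltr_wpDl.
(* This bound may depend on [T1] but restricts only the log coordinates of [x], which leaves the
   other side of the box free. *)
have /choice[C2 C2P] : forall a, exists b : R, 0 <= b /\ forall x : E,
    (forall b, is_height b -> 0 <= x 0 b <= T1) -> `|F a x| <= b.
  move=> a; have [cw [ca [B [B' vE]]]] := dual_fieldE j0 W al k0 a.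
  have T1e : 1 <= expR T1 by rewrite -expR0 ler_expR ltW.
  have [b1 b10 b1P] := strip_bounded emb adm cw B T1e W_C1 W_act.
  have [b2 b20 b2P] := strip_bounded emb adm ca B' T1e al_C1 al_act.
  exists (expR (\sum_(b | is_height b) T1) * (b1 + b2)); split;
    first by rewrite mulr_ge0 ?expR_ge0 ?addr_ge0.
  move=> x xT; rewrite /F /log_field normrM ger0_norm ?expR_ge0 //;
    apply: ler_pM; rewrite ?expR_ge0 //.
    (* The log sides start at 0, so the subtracted coordinates are nonnegative. *)
    rewrite ler_expR /log_weight;
      have /andP[q0 _] := xT q (is_height_rshift j0).
    have : \sum_(b | is_height b) x 0 b <= \sum_(b | is_height b) T1.
      by apply: ler_sum => b /xT/andP[].
    have : 0 <= (is_height a)%:R * x 0 a.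
      by case: (boolP (is_height a)) => [/xT/andP[]|]; rewrite ?mul1r ?mul0r.
    by move=> ? ?; lra.
  have hT j : 1 <= height j (exp_coords is_height x) <= expR T1.
    have /andP[l h] := xT _ (is_height_rshift j).
    by rewrite /height mxE is_height_rshift -{1}expR0 !ler_expR l.
  rewrite /v vE raddfD; apply: le_trans (ler_normD _ _) _.
  by apply: lerD; [apply: b1P|apply: b2P].
pose S2 : R := \sum_a C2 a; have S20 : 0 <= S2 by apply: sumr_ge0 => a _;
  exact: (C2P a).1.
pose T2 : R := 4 * (S2 + 1) / c;
  have T20 : 0 < T2 by rewrite divr_gt0 // mulr_gt0 // ltr_wpDl.
have := @box_divergence R (n + n) (fun a => if is_height a then T1 else T2)
  (fun a => if is_height a then C1 a else C2 a) F d.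
case=> [a|a x|a|a x xb|x xb].
- by case: ifP.
- exact: log_field_is_derive.
- exact: log_field_deriv_continuous.
- case: ifP => ha; first exact: (C1P a).2.
  apply: (C2P a).2 => b hb; have := xb b; by rewrite hb.
move=> le; have : c <= 2 * S1 / T1 + 2 * S2 / T2.
  apply: le_trans (cP x) _; apply: le_trans le _.
  rewrite !mulr_sumr !mulr_suml -big_split /=; apply: ler_sum => a _.
  have p1 : 0 <= 2 * C1 a / T1 by apply: divr_ge0;
    [apply: mulr_ge0 => //; exact: (C1P a).1|exact: ltW].
  have p2 : 0 <= 2 * C2 a / T2 by apply: divr_ge0;
    [apply: mulr_ge0 => //; exact: (C2P a).1|exact: ltW].
  by case: ifP => _; rewrite ?lerDl ?lerDr.
rewrite leNgt => /negP; apply.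
have half S T : 0 <= S -> T = 4 * (S + 1) / c -> 2 * S / T < c / 2.
  move=> S0 ->; have S1' : 0 < S + 1 by rewrite ltr_wpDl.
  have -> : 2 * S / (4 * (S + 1) / c) = c / 2 * (S / (S + 1)).
    by field; rewrite !gt_eqF.
  by rewrite gtr_pMr ?divr_gt0 // ltr_pdivrMr // mul1r ltrDl.
by rewrite [ltRHS](splitr c); apply: ltrD; apply: half.
Qed.

End Contradiction.

Theorem proposition6 (R : realType) (K : fieldExtType rat) (s t : nat)
    (s_gt0 : (0 < s)%N) (t_gt0 : (0 < t)%N)
    (sigma : 'I_(s + t + t) -> {rmorphism K -> R[i]})
    (emb : embeddings_of_type sigma)
    (U : set K) (adm : admissible sigma U) :
  ~ exists g : chart R (s + t) (mtype (OT_manifold s_gt0 emb adm)) ->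
                 'rV[R]_((s + t) + (s + t)) -> 'M[R]_((s + t) + (s + t)),
      strongly_gauduchon g.
Proof.
move=> [g /strongly_gauduchon_lift[gh [al L]]].
pose W z := wedge_pow (s + t).-1 (fundamental_form (gh z)).
(* [k0] removes the sign, the factorial and the power of i from the coefficient of omega^(n-1),
   leaving a principal minor of a positive definite matrix. *)
apply: (@no_dual_pair R K s t sigma s_gt0 emb U adm W al
  (minor_coef (s + t).-1 * 'i%C ^+ (s + t).-1)^-1).
- apply: C1_wedge_pow; first exact: ot_cover_open.
  apply: C1_fundamental_form; first exact: ot_cover_open.
  exact: (lift_metric_C1 L).
- exact: (lift_form_C1 L).
- exact: (lift_eq L).
- by move=> h z Gh Mz; exact: (lift_power_act L Gh Mz).
- exact: (lift_form_act L).
- move=> z Mz; exact: (wedge_pow_fundamental_form (lift_sym L Mz)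
    (lift_pos L Mz) (lift_J L Mz)
    (@lift_increasing _ _)).
Qed.
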